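(* There is a universal numerical constant $C$ such that the following holds. Let $T$ be a finite abelian group, $X$ a real separable $(2,D)$-smooth Banach space with $D\ge1$, and let $f_j(t)=\sum_{i=1}^jA_i(t)\gamma_i$ ($0\le j\le N$, $t\in T$) be a family of predictable Gaussian sums in $X$ as described in the context, whose terminal square-function pseudometric $d=d_N$ is translation invariant, that is, $d(t,u)=\sigma(t-u)$ for a random function $\sigma:T\to[0,\infty)$. Then $$\mathbb E\max_{0\le j\le N}\operatorname{osc}_Tf_j\le CD\,\mathcal J(\mathbb E\sigma),$$ where $\operatorname{osc}_T f_j=\max_{t,u\in T}\|f_j(t)-f_j(u)\|$ and $(\mathbb E\sigma)(h)=\mathbb E\,\sigma(h)$. The inequality is understood in the extended sense when the right-hand side is infinite (in particular $\mathcal J(\mathbb E\sigma)=\infty$ if $\mathbb E\sigma(h)=\infty$ for some $h$).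
   Context: Smoothness: a Banach space $X$ is $(2,D)$-smooth if $\|x+y\|^2+\|x-y\|^2\le 2\|x\|^2+2D^2\|y\|^2$ for all $x,y\in X$. Predictable Gaussian sums: $(\mathcal F_j)_{j=0}^N$ is a filtration on a probability space; for each $i=1,\dots,N$, $\gamma_i$ is a standard Gaussian vector in $\mathbb R^{m_i}$ that is independent of $\mathcal F_{i-1}$ and $\mathcal F_i$-measurable; for each $t\in T$, $A_i(t):\mathbb R^{m_i}\to X$ is an $\mathcal F_{i-1}$-measurable random linear operator, with finite operator norm almost surely. Set $f_0(t)=0$ and $f_j(t)=\sum_{i=1}^jA_i(t)\gamma_i$. For a linear operator $A:\mathbb R^m\to X$, $\|A\|_\gamma=(\mathbb E\|Ag\|^2)^{1/2}$ with $g\sim N(0,I_m)$. The terminal square-function pseudometric is $d(t,u)=\big(\sum_{i=1}^N\|A_i(t)-A_i(u)\|_\gamma^2\big)^{1/2}$. Homogeneous entropy: let $\mu$ be the normalized counting measure on $T$. For a symmetric subadditive function $\sigma$ on $T$ with nonnegative values and $\sigma(0)=0$, $$\mathcal J(\sigma)=\int_0^{\Delta_\sigma}\sqrt{\log\frac{e}{\mu\{h\in T:\sigma(h)\le r\}}}\,dr,\qquad \Delta_\sigma=\max_{h\in T}\sigma(h).$$ *)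

(* Defs.v *)
From HB Require Import structures.
From mathcomp Require Import all_boot all_order all_algebra.
From mathcomp Require Import all_classical all_reals all_analysis.
From mathcomp Require Import measurable_realfun.

Set Implicit Arguments.
Unset Strict Implicit.
Unset Printing Implicit Defensive.

Import Order.TTheory GRing.Theory Num.Theory.
Import numFieldNormedType.Exports.

Local Open Scope classical_set_scope.
Local Open Scope ring_scope.

Section gaussian_measure.
Variable R : realType.

Definition tuple_cons (m : nat) (p : measurableTypeR R * m.-tuple (measurableTypeR R)) :
  m.+1.-tuple (measurableTypeR R) := [tuple of p.1 :: p.2].

Lemma measurable_tuple_cons (m : nat) : measurable_fun setT (@tuple_cons m).
Proof. exact: measurable_cons. Qed.

HB.instance Definition _ (m : nat) :=
  isMeasurableFun.Build _ _ _ _ (@tuple_cons m) (@measurable_tuple_cons m).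

(* N(0, I_m), on the product (hence Borel) sigma-algebra of m.-tuples: the m-fold
   product of N(0, 1).  Linear operators act on 'cV[R]_m, see col_of_tuple. *)
Fixpoint std_gauss (m : nat) :
    probability (m.-tuple (measurableTypeR R)) R :=
  match m with
  | 0 => dirac ([tuple] : 0.-tuple (measurableTypeR R))
  | m'.+1 => distribution (normal_prob (0 : R) 1 \x std_gauss m')%E
                          (@tuple_cons m')
  end.
End gaussian_measure.

Section banach.
Variables (R : realType) (X : normedModType R).

Definition separable (U : topologicalType) : Prop :=
  exists2 S : set U, countable S & dense S.

Definition smooth2 (D : R) : Prop := forall x y : X,
  `|x + y| ^+ 2 + `|x - y| ^+ 2 <= 2 * `|x| ^+ 2 + 2 * D ^+ 2 * `|y| ^+ 2.

(* Operator norm with respect to the Euclidean norm on R^m (the library's norm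
   on matrices is the sup norm). *)
Definition op_norm (m : nat) (L : 'cV[R]_m -> X) : \bar R :=
  ereal_sup [set (`|L v|)%:E |
    v in [set v : 'cV[R]_m | \sum_(k < m) v k 0 ^+ 2 <= 1]].

Definition col_of_tuple (m : nat) (g : m.-tuple (measurableTypeR R)) :
  'cV[R]_m := \col_(k < m) tnth g k.

Definition gamma_norm (m : nat) (L : 'cV[R]_m -> X) : \bar R :=
  sqrte 'E_(std_gauss R m)[fun g => `|L (col_of_tuple g)| ^+ 2].

End banach.

Definition measurable_wrt (Omega U : Type) (F : set (set Omega))
    (G : set (set U)) (f : Omega -> U) : Prop :=
  preimage_set_system setT f G `<=` F.

Section predictable_sums.
Context (R : realType) (d : measure_display) (Omega : measurableType d).
Variables (P : probability Omega R) (X : normedModType R) (T : finType).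
Variable N : nat.

Definition filtration (F : nat -> set (set Omega)) : Prop :=
  (forall j, (j <= N)%N -> sigma_algebra setT (F j) /\ F j `<=` measurable) /\
  (forall j, (j < N)%N -> F j `<=` F j.+1).

(* Summands are indexed from 0: index i < N stands for the (i+1)-st summand,
   so A i is F i-measurable and gamma i is F i.+1-measurable; nothing is
   assumed at, and nothing depends on, the indices i >= N.  As X is separable
   and 'cV_m is finite dimensional, measurability of a random operator is
   measurability of its values at vectors, for the Borel sets of X. *)
Record predictable_gaussian (F : nat -> set (set Omega)) (m : nat -> nat)
    (gamma : forall i, Omega -> (m i).-tuple (measurableTypeR R))
    (A : forall i, T -> Omega -> {linear 'cV[R]_(m i) -> X}) : Prop := {
  pg_filtration : filtration F;
  pg_gauss : forall i, (i < N)%N -> forall B, measurable B ->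
    P (gamma i @^-1` B) = std_gauss R (m i) B;
  pg_indep : forall i, (i < N)%N -> forall E B, F i E -> measurable B ->
    P (E `&` gamma i @^-1` B) = (P E * P (gamma i @^-1` B))%E;
  pg_adapted : forall i, (i < N)%N ->
    measurable_wrt (F i.+1) measurable (gamma i);
  pg_predictable : forall i, (i < N)%N -> forall t v,
    measurable_wrt (F i) <<s @open X >> (fun w => A i t w v);
  pg_bounded : forall i, (i < N)%N -> forall t,
    {ae P, forall w, (op_norm (A i t w) < +oo)%E} }.

Variables (m : nat -> nat)
  (gamma : forall i, Omega -> (m i).-tuple (measurableTypeR R))
  (A : forall i, T -> Omega -> {linear 'cV[R]_(m i) -> X}).

Definition gauss_sum (j : nat) (t : T) (w : Omega) : X :=
  \sum_(i < j) A i t w (col_of_tuple (gamma i w)).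

Definition osc (f : T -> X) : R :=
  \big[Num.max/0]_(t : T) \big[Num.max/0]_(u : T) `|f t - f u|.

Definition sq_dist (w : Omega) (t u : T) : \bar R :=
  sqrte (\sum_(i < N) gamma_norm (A i t w \- A i u w)%R ^+ 2)%E.

Definition max_osc (w : Omega) : R :=
  \big[Num.max/0]_(j < N.+1) osc (fun t => gauss_sum j t w).

End predictable_sums.

Section entropy.
Variables (R : realType) (T : finType).
Local Open Scope ereal_scope.

Definition unif_meas (A : {pred T}) : R := (#|A|%:R / #|T|%:R)%R.

(* unif_meas only vanishes below min s, which is 0 for a pseudometric modulus;
   s may take the value +oo. *)
Definition entropy_int (s : T -> \bar R) : \bar R :=
  \int[@lebesgue_measure R]_(r in [set r | 0 <= r%:E <= \big[maxe/0]_(h : T) s h])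
    (Num.sqrt (ln (expR 1 / unif_meas [pred h | (s h <= r%:E)%E])))%:E.

(* When s takes the value +oo the range of integration is [0, +oo[ and the
   integrand is at least 1, so the formula itself yields +oo. *)
Lemma entropy_int_pinfty (s : T -> \bar R) (h0 h : T) :
  s h0 = 0 -> s h = +oo -> entropy_int s = +oo.
Proof.
move=> sh0 sh; apply/eqP; rewrite -leye_eq.
have Dom : [set r : R | 0 <= r%:E <= \big[maxe/0]_(h : T) s h] =
    `[0%R, +oo[%classic.
  rewrite (_ : \big[maxe/0]_(h : T) s h = +oo); last first.
    by apply/eqP; rewrite -leye_eq -sh; exact: le_bigmax.
  by apply/seteqP; split=> r /=; rewrite in_itv/= lee_fin leey !andbT.
rewrite /entropy_int Dom.
have T0 : (0 < #|T|)%N by apply/card_gt0P; exists h.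
have k0 (r : R) : (0 <= r)%R -> (0 < #|[pred h | (s h <= r%:E)%E]|)%N.
  by move=> r0; apply/card_gt0P; exists h0; rewrite inE /= sh0 lee_fin.
have q0 (k : nat) : (0 < k)%N -> (0 < k%:R / #|T|%:R :> R)%R.
  by move=> ?; rewrite divr_gt0// ltr0n.
have e0 (k : nat) : (0 < k)%N -> (0 < expR 1 / (k%:R / #|T|%:R) :> R)%R.
  by move=> /q0 ?; rewrite divr_gt0// expR_gt0.
have ge1 (r : R) : (0 <= r)%R ->
    (1 <= ln (expR 1 / unif_meas [pred h | (s h <= r%:E)%E]))%R.
  move=> /k0 kr; have kT := max_card [pred h | (s h <= r%:E)%E].
  rewrite -[leLHS]expRK /unif_meas ler_ln ?posrE ?expR_gt0 ?e0//.
  rewrite ler_pdivlMr ?q0// ler_piMr ?expR_ge0//.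
  by rewrite ler_pdivrMr ?ltr0n// mul1r ler_nat.
apply: (@le_trans _ _ (\int[@lebesgue_measure R]_(r in `[0%R, +oo[) cst 1 r)).
  rewrite integral_cst// mul1e.
  by rewrite [leRHS](@lebesgue_measure_itv R `[0%R, +oo[)/= ltry.
apply: ge0_le_integral => //=.
  apply/measurable_EFinP.
  apply: (eq_measurable_fun (fun r : R => Num.sqrt (ln (expR 1 /
      unif_meas [pred h | (s h <= (Num.max 0 r)%:E)%E])))%R).
    by move=> r; rewrite inE/= in_itv/= andbT => r0; rewrite max_r.
  apply: nonincreasing_measurable => // r t rt.
  have m0 (u : R) : (0 <= Num.max 0 u)%R by rewrite le_max lexx.
  rewrite ler_sqrt ?(le_trans ler01) ?ge1//.
  rewrite /unif_meas ler_ln ?posrE ?e0 ?k0//.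
  rewrite ler_pM2l ?expR_gt0// lef_pV2 ?posrE ?q0 ?k0//.
  rewrite ler_pM2r ?invr_gt0 ?ltr0n// ler_nat subset_leq_card//.
  apply/fintype.subsetP => x; rewrite !inE /= => /le_trans; apply.
  by rewrite lee_fin le_max2.
move=> r; rewrite in_itv/= andbT lee_fin => r0.
by rewrite -[leLHS]sqrtr1 ler_sqrt ?ge1// (le_trans ler01) ?ge1.
Qed.

End entropy.

(* Main.v *)
Require Import Defs.
From HB Require Import structures.
From mathcomp Require Import all_boot all_order all_algebra.
From mathcomp Require Import all_classical all_reals all_analysis.
From mathcomp Require Import measurable_realfun ring lra.

(** Averaging 2-smoothness over x + y and x - y gives
    E cosh(th |x + G|) <= cosh(th |x|) E cosh(2 D th |G|) for a Gaussian vector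
    G; writing G as the sum of 2^n independent copies of 2^(-n/2) G leaves only
    the second moment of G, so that cosh(th |f_j|) exp(-2 D^2 th^2 Q_j), with Q_j the
    predictable square function, is a supermartingale.  Cutting the increments
    at the dyadic levels of sqrt Q_j and applying Ville's inequality on each
    level yields, as soon as E sigma(x - y) <= a, the self-normalized bound
      max_j |f_j(x) - f_j(y)| <= 4 lam D (sigma(x - y) + a) + W,
      E W <= 20 D a exp(-lam^2 / 8).
    One then chains along the averages of f_j over the translates t + B_k of the
    balls B_k = {E sigma <= 2^-k Delta}: by translation invariance the main
    term of a link does not depend on t, hence can be averaged before taking
    expectations, while the errors W are summed over all pairs of points, lam
    being chosen as a multiple of sqrt(log(e |T| / |B_(k+1)|)). *)

Set Implicit Arguments.
Unset Strict Implicit.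
Unset Printing Implicit Defensive.

Import Order.TTheory GRing.Theory Num.Theory.
Import numFieldNormedType.Exports.

Local Open Scope classical_set_scope.
Local Open Scope ring_scope.

(** * Gaussian integrals *)

(** The function cosh is suited to smoothness because cosh sqrt(a^2 + c^2) <= cosh a cosh c turns a
    quadratic bound into a product. The main obstacle is that exponential bounds require a
    deterministic bound on the variance, while only the mean of sigma is controlled. On level l the
    variance is at most (2^l a)^2, and the process cut to that level stays at 0 unless Q_N exceeds
    the lower end of the level. A localized Ville inequality keeps the probability of this event as
    a factor, and the sum over l of 2^l a times these probabilities is at most a + 4 E sqrt Q_N, so
    a first moment suffices. In the chaining, a chosen net point pi(t) would leave the main term
    sigma(t - pi(t)), whose maximum over t is not controlled by E sigma; for averages over
    translates, t cancels in (t + b) - (t + b'). Only the errors W depend on the pair, and their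
    exponential factor pays for summing all of them. *)

Section gaussian_line.
Context {R : realType}.
Local Notation mu := (@lebesgue_measure R).
Local Open Scope ereal_scope.

(** The change of variables formula speaks of the Radon-Nikodym derivative, which agrees almost
    everywhere with [normal_pdf] because both have the same integral over every measurable set. *)
Lemma ge0_integral_normal_prob (m s : R) (f : R -> \bar R) :
  measurable_fun [set: R] f -> (forall x, 0 <= f x) ->
  \int[normal_prob m s]_x f x = \int[mu]_x (f x * (normal_pdf m s x)%:E).
Proof.
move=> mf f0.
have dom := normal_prob_dominates m s.
rewrite -(Radon_Nikodym_SigmaFinite.change_of_variables dom)//.
apply: ae_eq_integral => //.
- apply: emeasurable_funM => //; apply: (measurable_int mu).
  exact: (Radon_Nikodym_SigmaFinite.f_integrable dom).
- apply: emeasurable_funM => //; apply/measurable_EFinP.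
  exact: measurable_normal_pdf.
- apply: ae_eqe_mul2l => /=; apply: integral_ae_eq => //=.
  + exact: (Radon_Nikodym_SigmaFinite.f_integrable dom).
  + by apply/measurable_EFinP; exact: measurable_normal_pdf.
  + by move=> E _ mE; rewrite -(Radon_Nikodym_SigmaFinite.f_integral dom).
Qed.

(** [|b|] times the image of Lebesgue measure under the affine map gives every half-open interval
    its length, hence is Lebesgue measure by uniqueness. *)
Lemma ge0_integral_affine (b c : R) (f : R -> \bar R) : b != 0%R ->
  measurable_fun [set: R] f -> (forall x, 0 <= f x) ->
  \int[mu]_x f (b * x + c)%R = (`|b|^-1)%:E * \int[mu]_x f x.
Proof.
move=> b0 mf f0.
pose phi (x : R) : R := (b * x + c)%R.
have mphi : measurable_fun [set: measurableTypeR R] (phi : measurableTypeR R -> measurableTypeR R).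
  by apply: measurable_funD => //; apply: measurable_funM.
have b0' : (0 <= `|b|)%R by [].
pose nu0 : {measure set (measurableTypeR R) -> \bar R} :=
  measure_function_pushforward__canonical__measure_function_Measure mu mphi.
pose nu := mscale (NngNum b0') nu0.
have E : forall A, measurable A -> mu A = nu A.
  apply: lebesgue_measure_unique => _ [[x y]/= _ <-].
  rewrite /nu /mscale/= /nu0/= /pushforward/=.
  have [yx|xy] := leP y x.
    by rewrite set_itv_ge ?bnd_simp -?leNgt// preimage_set0 !measure0 mule0.
  have [bp|bn] := ltP 0%R b.
    rewrite (_ : _ @^-1` _ = `]((x - c) / b)%R, ((y - c) / b)%R]%classic).
      rewrite !lebesgue_measure_itv/= !lte_fin xy ltr_pM2r ?invr_gt0// ltrD2r xy.
      by rewrite -!EFinB -EFinM gtr0_norm//; congr EFin; field.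
    apply/seteqP; split=> z /=; rewrite !in_itv/= /phi ltr_pdivrMr// ler_pdivlMr//;
      by rewrite ltrBlDr lerBrDr (mulrC z).
  have {bn} bn : (b < 0)%R by rewrite lt_neqAle b0.
  (* For negative [b] the preimage is closed on the left and open on the right, which does not
     change its length. *)
  rewrite (_ : _ @^-1` _ = `[((y - c) / b)%R, ((x - c) / b)%R[%classic).
    rewrite !lebesgue_measure_itv/= !lte_fin xy ltr_nM2r ?invr_lt0// ltrD2r xy.
    by rewrite -!EFinB -EFinM ltr0_norm//; congr EFin; field.
  apply/seteqP; split=> z /=; rewrite !in_itv/= /phi ltr_ndivlMr// ler_ndivrMr//;
    by rewrite ltrBlDr lerBrDr (mulrC z) andbC.
rewrite [in RHS](eq_measure_integral nu); last by move=> A mA _; exact: E.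
rewrite /nu ge0_integral_mscale//= muleA -EFinM mulVf ?normr_eq0// mul1e.
by rewrite /nu0/= ge0_integral_pushforward//.
Qed.

Lemma normal_pdf01 (x : R) :
  normal_pdf 0 1 x = (normal_peak 1 * expR (- (x ^+ 2) / 2))%R.
Proof.
by rewrite normal_pdfE ?oner_neq0// /normal_fun subr0 expr1n.
Qed.

(** Substitute z = a x + b y at fixed x. The map (x, y) -> (a x + b y, b x - a y) is orthogonal, so
    the product of the densities at x and y equals the product at z and (x - a z) / b; this is [pp].
    Integrating in x first leaves the total mass of a normal density. *)
Lemma ge0_integral_normal_comb (a b : R) (f : R -> \bar R) :
  (a ^+ 2 + b ^+ 2 = 1)%R -> b != 0%R ->
  measurable_fun [set: R] f -> (forall x, 0 <= f x) ->
  \int[normal_prob 0 1]_x \int[normal_prob 0 1]_y f (a * x + b * y)%R =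
  \int[normal_prob (0 : R) 1]_x f x.
Proof.
move=> ab b0 mf f0.
pose p : R -> R := normal_pdf 0 1.
have p0 x : (0 <= p x)%R by exact: normal_pdf_ge0.
have mp : measurable_fun [set: R] p by exact: measurable_normal_pdf.
have bI : (b ^+ 2 != 0)%R by rewrite sqrf_eq0.
have pp (x z : R) : (p x * p ((z - a * x) / b) = p z * p ((x - a * z) / b))%R.
  rewrite /p !normal_pdf01 mulrACA [RHS]mulrACA -!expRD; congr (_ * expR _)%R.
  apply/eqP; rewrite -subr_eq0; apply/eqP.
  transitivity ((x ^+ 2 - z ^+ 2) * (1 - (a ^+ 2 + b ^+ 2)) / (2 * b ^+ 2))%R.
    by field.
  by rewrite ab subrr mulr0 mul0r.
pose h (w : R * R) : \bar R := f w.2 * (p w.1 * p ((w.2 - a * w.1) / b))%:E.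
have mh : measurable_fun [set: measurableTypeR R * measurableTypeR R] h.
  apply: emeasurable_funM; first exact: measurableT_comp.
  apply/measurable_EFinP/measurable_funM; first exact: measurableT_comp.
  apply: measurableT_comp => //; apply: measurable_funM => //.
  apply: measurable_funB => //; exact: measurable_funM.
have h0 w : 0 <= h w by rewrite mule_ge0// lee_fin mulr_ge0.
transitivity (\int[mu]_x (`|b|^-1%:E * \int[mu]_z h (x, z))).
  rewrite ge0_integral_normal_prob; first last.
  - by move=> x; apply: integral_ge0.
  - apply: (@measurable_fun_fubini_tonelli_F _ _ _ _ _
      (normal_prob 0 1) (fun w : R * R => f (a * w.1 + b * w.2)%R)) => //.
    apply: measurableT_comp => //.
    by apply: measurable_funD; exact: measurable_funM.
  apply: eq_integral => x _.
  have mhx : measurable_fun [set: R] (fun z => h (x, z)).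
    exact: (measurableT_comp mh).
  rewrite -(ge0_integral_affine (a * x) b0 mhx)//.
  have mfx : measurable_fun [set: R] (fun y => f (a * x + b * y)%R).
    by apply: measurableT_comp => //; apply: measurable_funD => //; exact: measurable_funM.
  rewrite ge0_integral_normal_prob// -ge0_integralZr//; first last.
  - by rewrite lee_fin.
  - by move=> y _; rewrite mule_ge0// lee_fin.
  - by apply: emeasurable_funM => //; exact/measurable_EFinP.
  apply: eq_integral => y _; rewrite /h/= -muleA -EFinM.
  rewrite (_ : (b * y + a * x - a * x) / b = y)%R; last by field.
  congr (f _ * _%:E); [exact: addrC | exact: mulrC].
have mhF : measurable_fun [set: R] (fun z => \int[mu]_x h (x, z)).
  exact: (@measurable_fun_fubini_tonelli_G _ _ _ _ _ mu h).
have mhG : measurable_fun [set: R] (fun x => \int[mu]_z h (x, z)).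
  exact: (@measurable_fun_fubini_tonelli_F _ _ _ _ _ mu h).
rewrite ge0_integralZl//=; first last.
  by move=> x _; exact: integral_ge0.
have -> : \int[mu]_x \int[mu]_z h (x, z) = \int[mu]_z \int[mu]_x h (x, z).
  exact: (@fubini_tonelli _ _ _ _ R mu mu h).
rewrite ge0_integral_normal_prob//.
transitivity (\int[mu]_z (`|b|^-1%:E * \int[mu]_x h (x, z))).
  rewrite ge0_integralZl; [by []|exact: measurableT|exact: mhF| |].
  - by move=> z _; exact: integral_ge0.
  - by rewrite lee_fin invr_ge0.
apply: eq_integral => z _.
under eq_integral do rewrite /h/= pp EFinM muleA.
have mq : measurable_fun [set: R] (fun x => (p ((x - a * z) / b))%:E).
  apply/measurable_EFinP; apply: measurableT_comp => //; apply: measurable_funM => //.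
  by apply: measurable_funB.
rewrite ge0_integralZl//; first last.
- by rewrite mule_ge0// lee_fin.
- by move=> x _; rewrite lee_fin.
rewrite muleCA (_ : _%:E * _ = 1) ?mule1//.
rewrite -(ge0_integral_affine (a * z) b0 mq)//; last by move=> x; rewrite lee_fin.
rewrite -[RHS](@integral_normal_pdf R 0 1); apply: eq_integral => x _.
rewrite (_ : (b * x + a * z - a * z) / b = x)%R//; by field.
Qed.

End gaussian_line.

(** * Rotations and exponential moments of the standard Gaussian vector *)

Section gaussian_tuples.
Context {R : realType}.
Local Notation mu := (@lebesgue_measure R).
Local Open Scope ereal_scope.

(** Completing the square: exp(c x) times the density of N(0, 1) is exp(c^2 / 2) times the density
    of N(c, 1). *)
Lemma normal_prob_expR_lty (c : R) :
  \int[normal_prob (0 : R) 1]_x (expR (c * x))%:E < +oo.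
Proof.
rewrite ge0_integral_normal_prob; first last.
- by move=> x; rewrite lee_fin expR_ge0.
- by apply/measurable_EFinP; apply: measurableT_comp => //; exact: measurable_funM.
have E (x : R) : (expR (c * x))%:E * (normal_pdf 0 1 x)%:E =
    (expR (c ^+ 2 / 2))%:E * (normal_pdf c 1 x)%:E.
  rewrite -!EFinM; congr EFin.
  rewrite !normal_pdfE ?oner_neq0// /normal_fun subr0 mulrCA [RHS]mulrCA.
  rewrite -!expRD; congr (_ * expR _)%R.
  by rewrite !expr1n; field.
under eq_integral do rewrite E.
rewrite ge0_integralZl//; first by rewrite integral_normal_pdf mule1 ltry.
- by apply/measurable_EFinP; exact: measurable_normal_pdf.
- by move=> x _; rewrite lee_fin normal_pdf_ge0.
Qed.

Lemma normal_prob_expR_abs_lty (c : R) :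
  \int[normal_prob (0 : R) 1]_x (expR (c * `|x|))%:E < +oo.
Proof.
have mE (b : R) : measurable_fun [set: R] (fun x => (expR (b * x))%:E).
  by apply/measurable_EFinP; apply: measurableT_comp => //; exact: measurable_funM.
apply: (@le_lt_trans _ _ (\int[normal_prob (0 : R) 1]_x
   ((expR (c * x))%:E + (expR (- c * x))%:E))).
  apply: ge0_le_integral => //.
  - apply/measurable_EFinP; apply: measurableT_comp => //; apply: measurable_funM => //.
  - by apply: emeasurable_funD; exact: mE.
  - move=> x _; rewrite -EFinD lee_fin.
    have [x0|x0] := leP 0%R x; first by rewrite (ger0_norm x0) lerDl expR_ge0.
    by rewrite (ltr0_norm x0) mulrN mulNr lerDr expR_ge0.
rewrite ge0_integralD//; [|exact: mE|exact: mE].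
by apply: lte_add_pinfty; exact: normal_prob_expR_lty.
Qed.

Lemma ge0_integral_std_gaussS (m : nat) (f : m.+1.-tuple (measurableTypeR R) -> \bar R) :
  measurable_fun [set: m.+1.-tuple (measurableTypeR R)] f -> (forall g, 0 <= f g) ->
  \int[std_gauss R m.+1]_g f g =
  \int[normal_prob (0 : R) 1]_x \int[std_gauss R m]_g f [tuple of x :: g].
Proof.
move=> mf f0.
rewrite [LHS](@ge0_integral_pushforward _ _ _ _ _ _ (@measurable_tuple_cons R m))//.
rewrite fubini_tonelli1//; last by move=> x; exact: f0.
by apply: measurableT_comp => //; exact: measurable_tuple_cons.
Qed.

Lemma ge0_integral_std_gauss0 (f : 0.-tuple (measurableTypeR R) -> \bar R) :
  measurable_fun [set: 0.-tuple (measurableTypeR R)] f ->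
  \int[std_gauss R 0]_g f g = f [tuple].
Proof. by move=> mf; rewrite integral_dirac// diracT mul1e. Qed.

Local Opaque std_gauss.

Definition comb_tuple (m : nat) (a b : R) (g h : m.-tuple (measurableTypeR R)) :
  m.-tuple (measurableTypeR R) := [tuple (a * tnth g i + b * tnth h i)%R | i < m].

Lemma comb_tupleS (m : nat) (a b : R) (x y : R) (g h : m.-tuple (measurableTypeR R)) :
  comb_tuple a b [tuple of x :: g] [tuple of y :: h] =
  [tuple of (a * x + b * y)%R :: comb_tuple a b g h].
Proof.
apply: eq_from_tnth => i; rewrite tnth_mktuple.
have [j ->|->] := unliftP ord0 i; last by rewrite !tnth0.
by rewrite !tnthS tnth_mktuple.
Qed.

Lemma measurable_comb_tuple d (T : measurableType d) (m : nat) (a b : R)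
    (g h : T -> m.-tuple (measurableTypeR R)) :
  measurable_fun [set: T] g -> measurable_fun [set: T] h ->
  measurable_fun [set: T] (fun t => comb_tuple a b (g t) (h t)).
Proof.
move=> mg mh; apply/measurable_fun_tnthP => i.
rewrite (_ : _ \o _ = fun t => (a * tnth (g t) i + b * tnth (h t) i)%R); last first.
  by apply/funext => t /=; rewrite tnth_mktuple.
by apply: measurable_funD; apply: measurable_funM => //;
  apply: (measurableT_comp (measurable_tnth i)).
Qed.

(** Serves two choices of coefficients: a = 0, b = -1 is the symmetry of the law, and a = b = 1 /
    sqrt 2 splits a Gaussian vector into two independent copies. The proof is by induction on the
    dimension: heads combine by the one-dimensional case and tails by the induction hypothesis. *)
Lemma ge0_integral_std_gauss_comb (m : nat) (a b : R)
    (f : m.-tuple (measurableTypeR R) -> \bar R) :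
  (a ^+ 2 + b ^+ 2 = 1)%R -> b != 0%R ->
  measurable_fun [set: m.-tuple (measurableTypeR R)] f -> (forall g, 0 <= f g) ->
  \int[std_gauss R m]_g \int[std_gauss R m]_h f (comb_tuple a b g h) =
  \int[std_gauss R m]_g f g.
Proof.
move=> ab b0.
have m1 n (h : n.-tuple (measurableTypeR R) -> \bar R) :
    measurable_fun [set: n.-tuple (measurableTypeR R)] h -> (forall g, 0 <= h g) ->
  measurable_fun [set: n.-tuple (measurableTypeR R)]
    (fun g => \int[std_gauss R n]_h' h (comb_tuple a b g h')).
  move=> mh h0; apply: (@measurable_fun_fubini_tonelli_F _ _ _ _ _ _
    (fun w : n.-tuple (measurableTypeR R) * n.-tuple (measurableTypeR R) =>
      h (comb_tuple a b w.1 w.2))) => //.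
  by apply: measurableT_comp => //; exact: measurable_comb_tuple.
elim: m => [|m IH] in f * => mf f0.
  rewrite !ge0_integral_std_gauss0//; last exact: m1.
  - by congr f; exact: tuple0.
  - by apply: measurableT_comp => //; exact: measurable_comb_tuple.
have mfx (x : R) : measurable_fun [set: m.-tuple (measurableTypeR R)]
    (fun g : m.-tuple (measurableTypeR R) => f [tuple of x :: g]).
  by apply: measurableT_comp => //; exact: measurable_cons.
rewrite ge0_integral_std_gaussS; [|exact: m1|by move=> g; exact: integral_ge0].
rewrite [RHS]ge0_integral_std_gaussS; [|exact: mf|exact: f0].
have step (x : R) : \int[std_gauss R m]_g \int[std_gauss R m.+1]_h
     f (comb_tuple a b [tuple of x :: g] h) =
   \int[normal_prob (0 : R) 1]_y \int[std_gauss R m]_g f [tuple of (a * x + b * y)%R :: g].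
  transitivity (\int[std_gauss R m]_g \int[normal_prob (0 : R) 1]_y \int[std_gauss R m]_h
     f [tuple of (a * x + b * y)%R :: comb_tuple a b g h]).
    apply: eq_integral => g _; rewrite ge0_integral_std_gaussS; last 2 first.
    - by apply: measurableT_comp => //; exact: measurable_comb_tuple.
    - by move=> h; exact: f0.
    by apply: eq_integral => y _; apply: eq_integral => h _; rewrite comb_tupleS.
  (* Tonelli moves the head [y] of the second vector outside the tail [g] of the first, so that the
     two tails become adjacent. *)
  etransitivity.
    apply: (@fubini_tonelli _ _ _ _ _ (std_gauss R m) (normal_prob (0 : R) 1)
      (fun w => \int[std_gauss R m]_h f [tuple of (a * x + b * w.2)%R :: comb_tuple a b w.1 h])).
  - apply: (@measurable_fun_fubini_tonelli_F _ _ _ _ _ _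
      (fun w : (m.-tuple (measurableTypeR R) * measurableTypeR R) * m.-tuple (measurableTypeR R) =>
        f [tuple of (a * x + b * w.1.2)%R :: comb_tuple a b w.1.1 w.2])) => //.
    apply: measurableT_comp => //; apply: measurable_cons.
      apply: measurable_funD => //; apply: measurable_funM => //.
      by apply: (measurableT_comp measurable_snd).
    apply: measurable_comb_tuple => //.
    by apply: (measurableT_comp measurable_fst).
  - by move=> w; exact: integral_ge0.
  apply: eq_integral => y _.
  exact: (IH (fun g : m.-tuple (measurableTypeR R) => f [tuple of (a * x + b * y)%R :: g])
    (mfx _) (fun g => f0 _)).
under eq_integral do rewrite step.
rewrite (@ge0_integral_normal_comb _ a b (fun x => \int[std_gauss R m]_g f [tuple of x :: g]))//.
- apply: (@measurable_fun_fubini_tonelli_F _ _ _ _ _ _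
      (fun w : measurableTypeR R * m.-tuple (measurableTypeR R) => f [tuple of w.1 :: w.2])) => //.
  by apply: measurableT_comp => //; exact: measurable_cons.
- by move=> x; exact: integral_ge0.
Qed.

Lemma std_gauss_expR_abs_lty (m : nat) (c : R) :
  \int[std_gauss R m]_g (expR (c * \sum_(i < m) `|tnth g i|))%:E < +oo.
Proof.
have mE n : measurable_fun [set: n.-tuple (measurableTypeR R)]
    (fun g : n.-tuple (measurableTypeR R) => (expR (c * \sum_(i < n) `|tnth g i|))%:E).
  apply/measurable_EFinP; apply: measurableT_comp => //; apply: measurable_funM => //.
  apply: measurable_sum => i; apply: measurableT_comp => //.
  exact: measurable_tnth.
elim: m => [|m IH].
  by rewrite ge0_integral_std_gauss0// ltry.
rewrite ge0_integral_std_gaussS//.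
have E (x : R) : \int[std_gauss R m]_g
    (expR (c * \sum_(i < m.+1) `|tnth [tuple of x :: g] i|))%:E =
    (expR (c * `|x|))%:E * \int[std_gauss R m]_g (expR (c * \sum_(i < m) `|tnth g i|))%:E.
  rewrite -ge0_integralZl//; last exact: mE.
  apply: eq_integral => g _; rewrite big_ord_recl tnth0 mulrDr expRD EFinM.
  by under eq_bigr do rewrite tnthS.
under eq_integral do rewrite E.
rewrite ge0_integralZr//=.
- apply: lte_mul_pinfty => //; first by apply: integral_ge0.
  rewrite ge0_fin_numE; last exact: integral_ge0.
  exact: normal_prob_expR_abs_lty.
- apply/measurable_EFinP; apply: measurableT_comp => //; apply: measurable_funM => //.
- by apply: integral_ge0.
Qed.

End gaussian_tuples.

(** * Hyperbolic cosine and smooth norms *)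

Section cosh.
Context {R : realType}.
Implicit Types a b c p q u v x y z : R.

Definition cosh x : R := (expR x + expR (- x)) / 2.

Lemma coshN x : cosh (- x) = cosh x.
Proof. by rewrite /cosh opprK addrC. Qed.

Lemma cosh_norm x : cosh `|x| = cosh x.
Proof. by have [x0|x0] := leP 0 x; rewrite ?(ger0_norm x0) ?(ltr0_norm x0) ?coshN. Qed.

Lemma cosh0 : cosh 0 = 1.
Proof. by rewrite /cosh oppr0 expR0; field. Qed.

Lemma cosh_gt0 x : 0 < cosh x.
Proof. by rewrite divr_gt0// addr_gt0// expR_gt0. Qed.

Lemma cosh_ge1 x : 1 <= cosh x.
Proof.
rewrite /cosh ler_pdivlMr// mul1r expRN.
have := expR_gt0 x; set e := expR x => e0.
rewrite -subr_ge0 (_ : _ - _ = (e - 1) ^+ 2 / e); last by field; rewrite gt_eqF.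
by rewrite divr_ge0 ?sqr_ge0// ltW.
Qed.

Lemma cosh_le x y : 0 <= x -> x <= y -> cosh x <= cosh y.
Proof.
move=> x0 xy; rewrite /cosh ler_pM2r ?invr_gt0//.
have ex : 1 <= expR x by rewrite -expR0 ler_expR.
have exy : expR x <= expR y by rewrite ler_expR.
rewrite !expRN; set e := expR x in ex exy *; set f := expR y in exy *.
have e0 : 0 < e by rewrite (lt_le_trans _ ex).
have f0 : 0 < f by rewrite (lt_le_trans e0).
rewrite -subr_ge0 (_ : _ - _ = (f - e) * (1 - e^-1 * f^-1)); last first.
  by field; rewrite !gt_eqF.
have fV : f^-1 <= 1 by rewrite invf_le1// (le_trans ex).
have eV : e^-1 <= 1 by rewrite invf_le1.
by rewrite mulr_ge0 ?subr_ge0// mulr_ile1 ?invr_ge0 ?(ltW e0) ?(ltW f0).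
Qed.

Lemma cosh_add_sub p q : cosh (p + q) + cosh (p - q) = 2 * (cosh p * cosh q).
Proof.
rewrite /cosh !opprD opprK !expRD; by field.
Qed.

Lemma cosh_sqr_le x : cosh x ^+ 2 <= cosh (2 * x).
Proof.
have := cosh_add_sub x x; rewrite subrr cosh0 (_ : x + x = 2 * x); last by ring.
have := cosh_ge1 (2 * x); rewrite expr2; set A := cosh _ * _; lra.
Qed.

Lemma expR_le_cosh x : expR x <= 2 * cosh x.
Proof. by rewrite /cosh mulrC divfK// lerDl expR_ge0. Qed.

(** The induction step is Chebyshev's inequality: p - q and p^k - q^k have the same sign. *)
Lemma power_mean2 p q k : 0 <= p -> 0 <= q -> 2 * ((p + q) / 2) ^+ k <= p ^+ k + q ^+ k.
Proof.
move=> p0 q0; elim: k => [|k IH]; first by rewrite !expr0; lra.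
apply: (@le_trans _ _ ((p + q) / 2 * (p ^+ k + q ^+ k))).
  rewrite exprS mulrCA; apply: ler_wpM2l => //.
  by rewrite divr_ge0// addr_ge0.
rewrite -subr_ge0 !exprS (_ : _ - _ = (p - q) * (p ^+ k - q ^+ k) / 2); last by field.
rewrite divr_ge0//; have [pq|pq] := leP p q.
  by rewrite mulr_le0// subr_le0// lerXn2r.
by rewrite mulr_ge0// subr_ge0 ?lerXn2r// ltW.
Qed.

(* Convexity of [u |-> cosh (sqrt u)], compared coefficientwise in the power series. *)
Lemma cosh_le_quadratic_mean p q z :
  p ^+ 2 + q ^+ 2 = 2 * z ^+ 2 -> 2 * cosh z <= cosh p + cosh q.
Proof.
move=> pqz.
pose S x n := series (exp_coeff x) n + series (exp_coeff (- x)) n.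
have cS x : S x n @[n --> \oo] --> 2 * cosh x.
  rewrite /cosh mulrC divfK//.
  by apply: cvgD; [exact: is_cvg_series_exp_coeff|exact: is_cvg_series_exp_coeff].
suff : 2 * (2 * cosh z) <= 2 * cosh p + 2 * cosh q.
  by rewrite -mulrDr ler_pM2l.
have c1 : 2 * S z n @[n --> \oo] --> 2 * (2 * cosh z).
  by apply: cvgM; [exact: cvg_cst|exact: cS].
have c2 : S p n + S q n @[n --> \oo] --> 2 * cosh p + 2 * cosh q.
  by apply: cvgD; exact: cS.
apply: (ler_cvg_to c1 c2).
near=> n.
rewrite /S /series/= -!big_split/= mulr_sumr; apply: ler_sum => i _.
rewrite /exp_coeff/= -!mulrDl mulrA ler_wpM2r ?invr_ge0//.
(* The odd coefficients cancel between x and -x. In degree 2k what remains is the power mean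
   inequality with exponent k for the squares of p and q, whose mean is z^2. *)
rewrite -(odd_double_half i); case: (odd i) => /=.
  by rewrite !add1n !exprS -!muln2 mulnC !exprM !sqrrN !mulNr !subrr !mulr0 addr0.
rewrite !add0n -!muln2 mulnC !exprM !sqrrN.
have := power_mean2 i./2 (sqr_ge0 p) (sqr_ge0 q).
rewrite pqz mulrAC divff// mul1r; lra.
Unshelve. all: by end_near. Qed.

(** The previous lemma with p = a + c and q = a - c, whose squares add up to 2 (a^2 + c^2). *)
Lemma cosh_le_sqrt a c z : z ^+ 2 = a ^+ 2 + c ^+ 2 -> cosh z <= cosh a * cosh c.
Proof.
move=> zac; rewrite -(@ler_pM2l _ 2)// -cosh_add_sub; apply: cosh_le_quadratic_mean.
by rewrite zac; ring.
Qed.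

(** Half-angle formula cosh v = 1 + 2 sinh(v / 2)^2 with sinh u <= u exp u and exp v <= 1 + v exp v.
    The cubic order of the remainder is what lets it disappear in the scaling limit of
    [gauss_cosh_le]. *)
Lemma cosh_le_poly v : 0 <= v -> cosh v <= 1 + v ^+ 2 / 2 + v ^+ 3 * expR v.
Proof.
move=> v0; set u := v / 2; have u0 : 0 <= u by rewrite divr_ge0.
have sinh_le x : 0 <= x -> (expR x - expR (- x)) / 2 <= x * expR x.
  move=> x0; have := expR_ge1Dx (- (2 * x)).
  have -> : expR (- x) = expR (- (2 * x)) * expR x by rewrite -expRD; congr expR; ring.
  have := expR_gt0 x; nra.
have E1 : expR v <= 1 + v * expR v.
  have := expR_ge1Dx (- v); rewrite expRN => h.
  have := expR_gt0 v => e0; move: h; rewrite -(@ler_pM2r _ (expR v))// mulVf ?gt_eqF//.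
  by lra.
have Ev : expR u ^+ 2 = expR v by rewrite -expRM_natl; congr expR; rewrite /u; field.
have -> : cosh v = 1 + 2 * ((expR u - expR (- u)) / 2) ^+ 2.
  rewrite /cosh -Ev -[- v]/(- v) (_ : expR (- v) = expR (- u) ^+ 2); last first.
    by rewrite -expRM_natl; congr expR; rewrite /u; field.
  have : expR u * expR (- u) = 1 by rewrite -expRD subrr expR0.
  set e := expR u; set f := expR (- u) => ef.
  rewrite (_ : 2 * _ = (e ^+ 2 + f ^+ 2) / 2 - e * f); last by field.
  by rewrite ef; lra.
rewrite -addrA lerD2l.
have h := sinh_le _ u0.
have s0 : 0 <= (expR u - expR (- u)) / 2.
  by rewrite divr_ge0// subr_ge0 ler_expR; lra.
have : ((expR u - expR (- u)) / 2) ^+ 2 <= (u * expR u) ^+ 2 by rewrite lerXn2r// nnegrE mulr_ge0// expR_ge0.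
rewrite [X in _ <= X]exprMn Ev.
have -> : u ^+ 2 = v ^+ 2 / 4 by rewrite /u; field.
have : v ^+ 2 * expR v <= v ^+ 2 * (1 + v * expR v) by rewrite ler_wpM2l// sqr_ge0.
have : 0 <= v ^+ 3 * expR v by rewrite mulr_ge0 ?expR_ge0// exprn_ge0.
have -> : v ^+ 3 = v ^+ 2 * v by rewrite exprSr.
nra.
Qed.

End cosh.

Section smooth.
Context {R : realType} {X : normedModType R}.

(* (cosh p + cosh q)/2 = cosh((p+q)/2) cosh((p-q)/2), where p = th |x+y|, q = th |x-y|. *)
Lemma smooth2_cosh (D th : R) (x y : X) : smooth2 X D -> 1 <= D -> 0 <= th ->
  (cosh (th * `|x + y|) + cosh (th * `|x - y|)) / 2 <=
  cosh (th * `|x|) * cosh (2 * D * th * `|y|).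
Proof.
move=> sm D1 th0.
set p := th * `|x + y|; set q := th * `|x - y|.
have D0 : 0 <= D by rewrite (le_trans ler01).
set a := th * `|x|; set b := th * `|y|.
have p0 : 0 <= p by rewrite mulr_ge0.
have q0 : 0 <= q by rewrite mulr_ge0.
have b0 : 0 <= b by rewrite mulr_ge0.
have pq : p ^+ 2 + q ^+ 2 <= 2 * a ^+ 2 + 2 * (D * b) ^+ 2.
  rewrite !exprMn -!mulrDr.
  have := ler_wpM2l (sqr_ge0 th) (sm x y); lra.
have -> : (cosh p + cosh q) / 2 = cosh ((p + q) / 2) * cosh ((p - q) / 2).
  have := cosh_add_sub ((p + q) / 2) ((p - q) / 2).
  rewrite (_ : (p + q) / 2 + (p - q) / 2 = p); last by field.
  rewrite (_ : (p + q) / 2 - (p - q) / 2 = q); last by field.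
  by move=> ->; rewrite mulrC mulKf.
(* Smoothness bounds the quadratic mean of [p] and [q] by [z], hence also their half-sum; the
   half-difference is bounded by the triangle inequality alone. *)
set z := Num.sqrt (a ^+ 2 + (D * b) ^+ 2).
have zE : z ^+ 2 = a ^+ 2 + (D * b) ^+ 2 by rewrite sqr_sqrtr// addr_ge0 ?sqr_ge0.
have pqz : (p + q) / 2 <= z.
  rewrite -[leLHS]ger0_norm ?divr_ge0 ?addr_ge0// -sqrtr_sqr ler_wsqrtr//.
  by have := sqr_ge0 (p - q); rewrite sqrrB expr_div_n sqrrD; lra.
have pqb : `|(p - q) / 2| <= D * b.
  apply: (@le_trans _ _ b); last by rewrite ler_peMl.
  rewrite normrM (ger0_norm (_ : 0 <= 2^-1))// ler_pdivrMr// -mulrBr normrM (ger0_norm th0).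
  rewrite /b -mulrA ler_wpM2l// (le_trans (ler_dist_dist _ _))//.
  rewrite opprB addrC -addrA (addrA (- x)) (addrC (- x)) subrr add0r -mulr2n.
  by rewrite normrMn mulr_natr.
apply: (@le_trans _ _ (cosh z * cosh (D * b))).
  have h1 : cosh ((p + q) / 2) <= cosh z by rewrite cosh_le ?divr_ge0 ?addr_ge0.
  have h2 : cosh ((p - q) / 2) <= cosh (D * b) by rewrite -cosh_norm cosh_le.
  by rewrite ler_pM ?(ltW (cosh_gt0 _)).
(* One factor [cosh (D * b)] comes from splitting [cosh z], the other from the half-difference.
   Their product is at most cosh(2 D b), which is the origin of 2 D in the statement. *)
apply: (@le_trans _ _ (cosh a * cosh (D * b) * cosh (D * b))).
  by rewrite ler_pM2r ?cosh_gt0// cosh_le_sqrt.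
rewrite -mulrA ler_pM2l ?cosh_gt0// -expr2 (le_trans (cosh_sqr_le _))//.
by rewrite /b !mulrA.
Qed.

End smooth.

(** * Measurability of Banach-valued maps through norms *)

Section norm_measurable.
Context {R : realType} {X : normedModType R}.

Lemma separable_seq : separable X ->
  exists s : nat -> X, forall x e, 0 < e -> exists n, `|x - s n| < e.
Proof.
move=> [S cS dS]; have [s sS] := pcard_surjP cS.
exists s => x e e0.
have /dS : ball x e !=set0 by exists x; exact: ballxx.
case=> [|y [xy Sy]]; first exact: ball_open.
have [n _ snE] := sS _ Sy.
by exists n; rewrite snE; move: xy; rewrite -ball_normE.
Qed.

(** Measurability of the distance to every point, equivalent to Borel measurability when the space
    is separable. In this form all arguments concern real functions only. *)
Definition norm_measurable d (T : measurableType d) (U : T -> X) : Prop :=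
  forall x, measurable_fun [set: T] (fun w => `|U w - x|).

Lemma measurable_fun_ltr_preimage d (T : measurableType d) (f : T -> R) :
  (forall c, measurable [set w | f w < c]) -> measurable_fun [set: T] f.
Proof.
move=> mf mD; apply: (measurability _ (RGenInftyO.measurableE R)) => //.
move=> _ [_ [c ->] <-]; rewrite setTI.
by rewrite (_ : _ @^-1` _ = [set w | f w < c])//; apply/seteqP; split=> w/=; rewrite in_itv.
Qed.

Variables (s : nat -> X) (sX : forall x e, 0 < e -> exists n, `|x - s n| < e).

Lemma norm_measurable_cst d (T : measurableType d) (x : X) :
  norm_measurable (fun _ : T => x).
Proof. by move=> y; exact: measurable_cst. Qed.

Lemma norm_measurable_comp d d' (T : measurableType d) (T' : measurableType d')
  (phi : T' -> T) (U : T -> X) : measurable_fun [set: T'] phi ->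
  norm_measurable U -> norm_measurable (U \o phi).
Proof. by move=> mphi mU x; exact: (measurableT_comp (mU x)). Qed.

Lemma norm_measurable_norm d (T : measurableType d) (U : T -> X) :
  norm_measurable U -> measurable_fun [set: T] (fun w => `|U w|).
Proof. by move=> /(_ 0); under eq_fun do rewrite subr0. Qed.

(** |U + V - x| < c holds exactly when some point of the dense sequence is so close to U that the
    triangle inequality through it still gives less than c; the event is thus a countable union of
    events on real functions. *)
Lemma norm_measurableD d (T : measurableType d) (U V : T -> X) :
  norm_measurable U -> norm_measurable V -> norm_measurable (fun w => U w + V w).
Proof.
move=> mU mV x; apply: measurable_fun_ltr_preimage => c.
rewrite (_ : [set _ | _] = \bigcup_n [set w | `|U w - s n| + `|V w - (x - s n)| < c]).
  apply: bigcup_measurable => n _.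
  rewrite (_ : [set _ | _] = (fun w => `|U w - s n| + `|V w - (x - s n)|) @^-1` `]-oo, c[%classic).
    have mUV : measurable_fun [set: T] (fun w => `|U w - s n| + `|V w - (x - s n)|).
      exact: measurable_funD.
    by have := mUV measurableT _ (measurable_itv `]-oo, c[); rewrite setTI.
  by apply/seteqP; split=> w/=; rewrite in_itv.
apply/seteqP; split=> w/=.
  move=> h; have [n hn] := sX (U w) (e := (c - `|U w + V w - x|) / 2) ltac:(lra).
  exists n => //=.
  have : `|V w - (x - s n)| <= `|U w + V w - x| + `|U w - s n|.
    rewrite [X in _ <= _ + `|X|](_ : _ = - (s n - U w)) ?normrN; last by rewrite opprB.
    apply: le_trans (ler_normD _ _); rewrite le_eqVlt; apply/orP; left; apply/eqP; congr (`|_|).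
    by rewrite opprB addrA [RHS]addrC !addrA subrK (addrC (V w)).
  lra.
move=> [n _ h]; apply: le_lt_trans h; apply: le_trans (ler_normD _ _).
rewrite le_eqVlt; apply/orP; left; apply/eqP; congr (`|_|).
by rewrite opprB (addrC (V w) (s n - x)) !addrA subrK addrAC.
Qed.

Lemma norm_measurableZ d (T : measurableType d) (c : T -> R) (U : T -> X) :
  measurable_fun [set: T] c ->
  norm_measurable U -> norm_measurable (fun w => c w *: U w).
Proof.
move=> mc mU x; apply: measurable_fun_ltr_preimage => r.
rewrite (_ : [set _ | _] = \bigcup_n [set w | `|c w| * `|U w - s n| + `|c w *: s n - x| < r]).
  apply: bigcup_measurable => n _.
  rewrite (_ : [set _ | _] = (fun w => `|c w| * `|U w - s n| + `|c w *: s n - x|) @^-1` `]-oo, r[%classic).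
    have cn : continuous (fun t : R => `|t *: s n - x|).
      move=> t; apply: cvg_norm; apply: cvgB; last exact: cvg_cst.
      by apply: cvgZr_tmp; exact: cvg_id.
    have mUV : measurable_fun [set: T] (fun w => `|c w| * `|U w - s n| + `|c w *: s n - x|).
      apply: measurable_funD; last exact: (measurableT_comp (continuous_measurable_fun cn)).
      by apply: measurable_funM => //; exact: measurableT_comp.
    by have := mUV measurableT _ (measurable_itv `]-oo, r[); rewrite setTI.
  by apply/seteqP; split=> w/=; rewrite in_itv.
apply/seteqP; split=> w/=.
  move=> h; have c1 : 0 < `|c w| * 2 + 1 by have := normr_ge0 (c w); lra.
  (* The error of approximating [U w] enters twice, each time multiplied by [|c w|]; the added 1
     keeps the denominator positive when [c w] is 0. *)
  have [n hn] := sX (U w) (e := (r - `|c w *: U w - x|) / (`|c w| * 2 + 1)) ltac:(apply: divr_gt0 => //; lra).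
  exists n => //=.
  have : `|c w *: s n - x| <= `|c w *: U w - x| + `|c w| * `|U w - s n|.
    rewrite -normrZ scalerBr.
    rewrite [X in _ <= _ + `|X|](_ : _ = - (c w *: s n - c w *: U w)) ?normrN; last by rewrite opprB.
    apply: le_trans (ler_normD _ _); rewrite le_eqVlt; apply/orP; left; apply/eqP; congr (`|_|).
    by rewrite [RHS]addrC addrA subrK.
  move: hn; rewrite ltr_pdivlMr//; have := normr_ge0 (U w - s n); have := normr_ge0 (c w).
  nra.
move=> [n _ h]; apply: le_lt_trans h; rewrite -normrZ scalerBr.
apply: le_trans (ler_normD _ _).
rewrite le_eqVlt; apply/orP; left; apply/eqP; congr (`|_|).
by rewrite addrA subrK.
Qed.

Lemma norm_measurable_sum d (T : measurableType d) (I : Type) (r : seq I) (U : I -> T -> X) :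
  (forall i, norm_measurable (U i)) -> norm_measurable (fun w => \sum_(i <- r) U i w).
Proof.
move=> mU; elim: r => [|i r IH].
  by under eq_fun do rewrite big_nil; exact: norm_measurable_cst.
under eq_fun do rewrite big_cons; exact: norm_measurableD.
Qed.

End norm_measurable.

Section linear_measurable.
Context {R : realType} {X : normedModType R}.
Variables (s : nat -> X) (sX : forall x e, 0 < e -> exists n, `|x - s n| < e).

Lemma linear_col_of_tuple m (L : {linear 'cV[R]_m -> X}) (g : m.-tuple (measurableTypeR R)) :
  L (col_of_tuple g) = \sum_(i < m) tnth g i *: L (delta_mx i 0).
Proof.
rewrite {1}[col_of_tuple g]matrix_sum_delta linear_sum; apply: eq_bigr => i _.
by rewrite big_ord1 linearZ mxE.
Qed.

Lemma linear_comb_tuple m (L : {linear 'cV[R]_m -> X}) (a b : R)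
    (g h : m.-tuple (measurableTypeR R)) :
  L (col_of_tuple (comb_tuple a b g h)) = a *: L (col_of_tuple g) + b *: L (col_of_tuple h).
Proof.
rewrite -!linearZ -linearD; congr (L _); apply/matrixP => i j.
by rewrite !mxE tnth_mktuple.
Qed.

(** A random operator is known to be measurable only at fixed vectors; expanding the random argument
    in the canonical basis reduces to those. *)
Lemma norm_measurable_linear d (T : measurableType d) m
    (B : T -> {linear 'cV[R]_m -> X}) (g : T -> m.-tuple (measurableTypeR R)) :
  (forall v, norm_measurable (fun w => B w v)) -> measurable_fun [set: T] g ->
  norm_measurable (fun w => B w (col_of_tuple (g w))).
Proof.
move=> mB mg; under eq_fun do rewrite linear_col_of_tuple.
apply: (norm_measurable_sum sX) => i; apply: (norm_measurableZ sX) => //.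
exact: (measurableT_comp (measurable_tnth i)).
Qed.

Lemma measurable_cosh : measurable_fun [set: R] (@cosh R).
Proof.
apply: measurable_funM => //; apply: measurable_funD => //.
exact: measurableT_comp.
Qed.

End linear_measurable.

Lemma probability_integral_cst {R : realType} d (T : measurableType d)
  (P : probability T R) (k : \bar R) : (\int[P]_w k = k)%E.
Proof.
rewrite integral_cst//.
rewrite -[RHS]mule1; congr (_ * _)%E; exact: probability_setT.
Qed.

(** * Exponential moments of one Gaussian increment *)

Section gauss_step.
Context {R : realType} {X : normedModType R}.
Variables (s : nat -> X) (sX : forall x e, 0 < e -> exists n, `|x - s n| < e).
Variables (m : nat) (L : {linear 'cV[R]_m -> X}).
Local Open Scope ereal_scope.
Local Opaque std_gauss.

Let y (g : m.-tuple (measurableTypeR R)) : X := L (col_of_tuple g).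

Let my : norm_measurable y.
Proof.
apply: (norm_measurable_linear sX (B := fun=> L)) => // v.
exact: norm_measurable_cst.
Qed.

Let mny : measurable_fun [set: m.-tuple (measurableTypeR R)] (fun g => `|y g|%R).
Proof. exact: norm_measurable_norm. Qed.

Lemma std_gauss_expR_norm_lty (c : R) : (0 <= c)%R ->
  \int[std_gauss R m]_g (expR (c * `|L (col_of_tuple g)|))%:E < +oo.
Proof.
move=> c0; pose K := (\sum_(i < m) `|L (delta_mx i ord0)|)%R.
apply: le_lt_trans (std_gauss_expR_abs_lty m (c * K)).
apply: ge0_le_integral => //.
- apply/measurable_EFinP; apply: measurableT_comp => //; exact: measurable_funM.
- apply/measurable_EFinP; apply: measurableT_comp => //; apply: measurable_funM => //.
  apply: measurable_sum => i; apply: measurableT_comp => //; exact: measurable_tnth.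
move=> g _; rewrite lee_fin ler_expR -mulrA ler_wpM2l// linear_col_of_tuple.
rewrite (le_trans (ler_norm_sum _ _ _))// mulr_sumr; apply: ler_sum => i _.
rewrite normrZ mulrC ler_wpM2r// /K (bigD1 i)//= lerDl sumr_ge0//.
Qed.

Lemma std_gauss_dominated_lty (k c : R) (f : m.-tuple (measurableTypeR R) -> R) :
  (0 <= c)%R -> (0 <= k)%R -> measurable_fun [set: m.-tuple (measurableTypeR R)] f ->
  (forall g, 0 <= f g <= k * expR (c * `|L (col_of_tuple g)|))%R ->
  \int[std_gauss R m]_g (f g)%:E < +oo.
Proof.
move=> c0 k0 mf fb.
apply: (@le_lt_trans _ _ (k%:E * \int[std_gauss R m]_g (expR (c * `|L (col_of_tuple g)|))%:E)).
  rewrite -ge0_integralZl//; last first.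
    apply/measurable_EFinP; apply: measurableT_comp => //; exact: measurable_funM.
  apply: ge0_le_integral => //.
  - by move=> g _; rewrite lee_fin; have /andP[] := fb g.
  - exact/measurable_EFinP.
  - apply/measurable_EFinP; apply: measurable_funM => //; apply: measurableT_comp => //; exact: measurable_funM.
  - by move=> g _; rewrite -EFinM lee_fin; have /andP[] := fb g.
by apply: lte_mul_pinfty => //; exact: std_gauss_expR_norm_lty.
Qed.

Lemma exprn_le_expR (x : R) n : (0 <= x)%R -> (x ^+ n.+1 <= n.+1`!%:R * expR x)%R.
Proof.
move=> x0; have := expR_ge1Dxn n x0 => h.
rewrite mulrC -ler_pdivrMr ?ltr0n ?fact_gt0//; lra.
Qed.

(** The square of [gamma_norm] as a real number. [fine] would send an infinite integral to 0;
    [gauss_varE] shows that the integral is finite. *)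
Definition gauss_var : R := fine (\int[std_gauss R m]_g (`|L (col_of_tuple g)| ^+ 2)%:E).

Lemma gauss_varE : \int[std_gauss R m]_g (`|L (col_of_tuple g)| ^+ 2)%:E = gauss_var%:E.
Proof.
rewrite fineK// ge0_fin_numE; last first.
  by apply: integral_ge0 => g _; rewrite lee_fin sqr_ge0.
apply: (@std_gauss_dominated_lty 2 1) => //; first exact: measurable_funX.
move=> g; rewrite sqr_ge0/= mul1r; exact: exprn_le_expR.
Qed.

Lemma gauss_var_ge0 : (0 <= gauss_var)%R.
Proof. by rewrite fine_ge0// integral_ge0// => g _; rewrite lee_fin sqr_ge0. Qed.

Lemma gamma_norm_sqr : gamma_norm L ^+ 2 = gauss_var%:E.
Proof.
rewrite /gamma_norm unlock /= gauss_varE /=.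
rewrite -EFinM -expr2 sqr_sqrtr//.
exact: gauss_var_ge0.
Qed.

Let Ecosh (th : R) (x : X) := \int[std_gauss R m]_g (cosh (th * `|x + y g|))%:E.

Let mcosh (th : R) (x : X) :
  measurable_fun [set: m.-tuple (measurableTypeR R)] (fun g => cosh (th * `|x + y g|))%R.
Proof.
apply: measurableT_comp; first exact: measurable_cosh.
apply: measurable_funM => //; apply: norm_measurable_norm.
by apply: (norm_measurableD sX) => //; exact: norm_measurable_cst.
Qed.

Let cosh_ge0 (x : R) : (0 <= cosh x)%R.
Proof. exact: ltW (cosh_gt0 _). Qed.

Let symm (th : R) (x : X) :
  \int[std_gauss R m]_g (cosh (th * `|x - y g|))%:E = Ecosh th x.
Proof.
rewrite /Ecosh -(@ge0_integral_std_gauss_comb _ _ 0 (-1) (fun g => (cosh (th * `|x + y g|))%:E)).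
- under [RHS]eq_integral do under eq_integral do
    rewrite /y linear_comb_tuple scale0r add0r scaleN1r.
  exact/esym/probability_integral_cst.
- by rewrite expr0n add0r sqrrN expr1n.
- by rewrite oppr_eq0 oner_eq0.
- apply/measurable_EFinP.
  exact: mcosh.
- by move=> g; rewrite lee_fin cosh_ge0.
Qed.

Variable D : R.
Hypotheses (D1 : (1 <= D)%R) (sm : smooth2 X D).

(** Integrates [smooth2_cosh], the symmetry of the law giving x + y and x - y the same expectation.
    This bound still involves all even moments of |y|. *)
Let base (th : R) (x : X) : (0 <= th)%R -> Ecosh th x <=
  (cosh (th * `|x|))%:E * \int[std_gauss R m]_g (cosh (2 * D * th * `|y g|))%:E.
Proof.
move=> th0.
have mneg : measurable_fun [set: m.-tuple (measurableTypeR R)] (fun g => cosh (th * `|x - y g|))%R.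
  apply: measurableT_comp; first exact: measurable_cosh.
  apply: measurable_funM => //; under eq_fun do rewrite distrC.
  exact: my.
have half (e : \bar R) : e = (2^-1)%:E * e + (2^-1)%:E * e.
  by rewrite -ge0_muleDl ?lee_fin// -EFinD (_ : _ + _ = 1)%R ?mul1e//; field.
have -> : Ecosh th x = \int[std_gauss R m]_g
    ((2^-1)%:E * (cosh (th * `|x + y g|))%:E + (2^-1)%:E * (cosh (th * `|x - y g|))%:E).
  rewrite ge0_integralD//=; first last.
  - by apply/measurable_EFinP; apply: measurable_funM.
  - by move=> g _; rewrite lee_fin mulr_ge0.
  - by apply/measurable_EFinP; apply: measurable_funM.
  - by move=> g _; rewrite lee_fin mulr_ge0.
  rewrite [LHS]half; congr (_ + _).
    rewrite ge0_integralZl//; last by move=> g _; rewrite lee_fin.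
    exact/measurable_EFinP.
  rewrite ge0_integralZl//; last by move=> g _; rewrite lee_fin.
    by congr (_ * _); apply/esym/symm.
  exact/measurable_EFinP.
have mc : measurable_fun [set: m.-tuple (measurableTypeR R)] (fun g => cosh (2 * D * th * `|y g|))%R.
  apply: measurableT_comp; first exact: measurable_cosh.
  exact: measurable_funM.
rewrite -ge0_integralZl//; last 3 first.
- exact/measurable_EFinP.
- by move=> g _; rewrite lee_fin.
- by rewrite lee_fin.
apply: ge0_le_integral => //.
- by move=> g _; rewrite -EFinD lee_fin addr_ge0// mulr_ge0.
- by apply/measurable_EFinP; apply: measurable_funD; apply: measurable_funM.
- by apply/measurable_EFinP; apply: measurable_funM.
- move=> g _; rewrite -!EFinM -EFinD lee_fin (le_trans _ (smooth2_cosh _ _ _ _ _))//.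
  by rewrite -mulrDr mulrC.
Qed.

Let r : R := (Num.sqrt 2)^-1%R.

Let r0 : (0 < r)%R.
Proof. by rewrite invr_gt0 sqrtr_gt0. Qed.

Let r2 : (r ^+ 2 = 2^-1)%R.
Proof. by rewrite exprVn sqr_sqrtr. Qed.

Let r1 : (r < 1)%R.
Proof.
rewrite -(@ltr_pXn2r _ 2) ?nnegrE ?(ltW r0) ?ler01// r2 expr1n invf_lt1 ?ltr1n//.
Qed.

Let Q (th k : R) := forall x, Ecosh th x <= (k * cosh (th * `|x|))%:E.

(** Write y = r (y_1 + y_2) with independent copies and take r out of the norm. The hypothesis at
    scale [th * r] is applied to y_2 with y_1 frozen, then to y_1, and each use costs a factor
    [k]. *)
Let halving (th k : R) : (0 <= th)%R -> (0 <= k)%R -> Q (th * r) k -> Q th (k ^+ 2).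
Proof.
move=> th0 k0 Qk x.
have rr : (r ^+ 2 + r ^+ 2 = 1)%R by rewrite r2; field.
have rn : r != 0%R by rewrite gt_eqF.
rewrite /Ecosh -(@ge0_integral_std_gauss_comb _ _ r r (fun g => (cosh (th * `|x + y g|))%:E))//; last 2 first.
- by apply/measurable_EFinP; exact: mcosh.
- by move=> g; rewrite lee_fin.
have E (g h : m.-tuple (measurableTypeR R)) :
   (cosh (th * `|x + y (comb_tuple r r g h)|) = cosh (th * r * `|(r^-1 *: x + y g) + y h|))%R.
  rewrite -mulrA -[in X in (th * (X * _))%R](gtr0_norm r0) -normrZ !scalerDr scalerA divff// scale1r.
  by rewrite /y linear_comb_tuple addrA.
under eq_integral do under eq_integral do rewrite E.
apply: (@le_trans _ _ (\int[std_gauss R m]_g (k%:E * (cosh (th * r * `|r^-1 *: x + y g|))%:E))).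
  apply: ge0_le_integral => //.
  - by move=> g _; apply: integral_ge0 => h _; rewrite lee_fin.
  - apply: (@measurable_fun_fubini_tonelli_F _ _ _ _ _ _
      (fun w : m.-tuple (measurableTypeR R) * m.-tuple (measurableTypeR R) =>
        (cosh (th * r * `|(r^-1 *: x + y w.1) + y w.2|))%:E)).
    + apply/measurable_EFinP; apply: measurableT_comp; first exact: measurable_cosh.
      apply: measurable_funM => //; apply: norm_measurable_norm.
      apply: (norm_measurableD sX); last exact: (norm_measurable_comp measurable_snd my).
      apply: (norm_measurableD sX); last exact: (norm_measurable_comp measurable_fst my).
      exact: norm_measurable_cst.
    + by move=> w; rewrite lee_fin.
  - by apply/measurable_EFinP; apply: measurable_funM => //; exact: mcosh.
  - by move=> g _; exact: Qk.
rewrite ge0_integralZl//; last 2 first.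
- by apply/measurable_EFinP; exact: mcosh.
- by move=> g _; rewrite lee_fin.
rewrite expr2 -mulrA EFinM lee_wpmul2l ?lee_fin//.
apply: le_trans (Qk _) _; rewrite lee_fin ler_wpM2l//.
have rV : (0 < r^-1)%R by rewrite invr_gt0.
by rewrite normrZ (gtr0_norm rV) mulrA mulfK.
Qed.

Let iter_halving (th k : R) n : (0 <= th)%R -> (0 <= k)%R ->
  Q (th * r ^+ n) k -> Q th (k ^+ (2 ^ n)).
Proof.
elim: n k => [|n IH] k th0 k0; first by rewrite expr0 mulr1 expn0 expr1.
rewrite exprSr mulrA => /halving h.
rewrite expnS exprM; apply: IH => //; first exact: exprn_ge0.
by apply: h => //; rewrite mulr_ge0// exprn_ge0// ltW.
Qed.

(* The bound [E cosh(th |x + y|) <= cosh(th |x|) E cosh(2 D th |y|)] is applied to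
   y = r^n (y_1 + ... + y_{2^n}), 2^n independent copies: only the quadratic term of
   E cosh(2 D th r^n |y|) survives as n goes to infinity. *)
Lemma gauss_cosh_le (th : R) (x : X) : (0 <= th)%R ->
  \int[std_gauss R m]_g (cosh (th * `|x + L (col_of_tuple g)|))%:E <=
  (cosh (th * `|x|) * expR (2 * D ^+ 2 * th ^+ 2 * gauss_var))%:E.
Proof.
move=> th0.
set c := (2 * D * th)%R.
have D0 : (0 <= D)%R by rewrite (le_trans ler01).
have c0 : (0 <= c)%R by rewrite !mulr_ge0.
have mK : measurable_fun [set: m.-tuple (measurableTypeR R)]
    (fun g => (c * `|y g|) ^+ 3 * expR (c * `|y g|))%R.
  apply: measurable_funM; first by apply: measurable_funX; exact: measurable_funM.
  by apply: measurableT_comp => //; exact: measurable_funM.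
have K_fin : \int[std_gauss R m]_g ((c * `|y g|) ^+ 3 * expR (c * `|y g|))%:E < +oo.
  apply: (@std_gauss_dominated_lty 6 (2 * c)) => //; first by rewrite mulr_ge0.
  move=> g; rewrite mulr_ge0 ?exprn_ge0 ?mulr_ge0 ?expR_ge0//=.
  rewrite -mulrA [X in (_ <= _ * expR X)%R]mulr_natl mulr2n expRD mulrA ler_wpM2r ?expR_ge0//.
  by have := @exprn_le_expR (c * `|y g|) 2 (mulr_ge0 c0 (normr_ge0 _)).
set K := fine (\int[std_gauss R m]_g ((c * `|y g|) ^+ 3 * expR (c * `|y g|))%:E).
have KE : \int[std_gauss R m]_g ((c * `|y g|) ^+ 3 * expR (c * `|y g|))%:E = K%:E.
  rewrite fineK// ge0_fin_numE//; apply: integral_ge0 => g _.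
  by rewrite lee_fin mulr_ge0 ?exprn_ge0 ?mulr_ge0 ?expR_ge0.
have K0 : (0 <= K)%R.
  rewrite fine_ge0// integral_ge0// => g _.
  by rewrite lee_fin mulr_ge0 ?exprn_ge0 ?mulr_ge0 ?expR_ge0.
set V := gauss_var.
have V0 : (0 <= V)%R := gauss_var_ge0.
(* Bound on E cosh(2 D th r^n |y|) from [cosh_le_poly]: the second moment appears with its exact
   coefficient, and since r^n <= 1 the constant [K] of the cubic term does not depend on n. *)
pose kk n := (1 + c ^+ 2 * r ^+ (2 * n) / 2 * V + r ^+ (3 * n) * K)%R.
have rn0 n : (0 <= r ^+ n)%R by rewrite exprn_ge0// ltW.
have kk0 n : (0 <= kk n)%R.
  by rewrite !addr_ge0// !mulr_ge0// ?sqr_ge0.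
have rn1 n : (r ^+ n <= 1)%R.
  by rewrite exprn_ile1 ?(ltW r0) ?(ltW r1).
have bnd n : \int[std_gauss R m]_g (cosh (2 * D * (th * r ^+ n) * `|y g|))%:E <= (kk n)%:E.
  apply: (@le_trans _ _ (\int[std_gauss R m]_g (1 + ((c ^+ 2 * r ^+ (2 * n) / 2)%:E * (`|y g| ^+ 2)%:E
      + (r ^+ (3 * n))%:E * ((c * `|y g|) ^+ 3 * expR (c * `|y g|))%:E)))).
    apply: ge0_le_integral => //.
    - by move=> g _; rewrite lee_fin.
    - apply/measurable_EFinP; apply: measurableT_comp; first exact: measurable_cosh.
      exact: measurable_funM.
    - apply/measurable_EFinP; apply: measurable_funD => //; apply: measurable_funD; apply: measurable_funM => //.
      exact: measurable_funX.
    - move=> g _; rewrite -!EFinM -!EFinD lee_fin mulrA -/c.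
      have cy0 : (0 <= c * `|y g|)%R by rewrite mulr_ge0.
      have u0 : (0 <= c * r ^+ n * `|y g|)%R by rewrite !mulr_ge0.
      apply: le_trans (cosh_le_poly u0) _; rewrite -addrA lerD2l lerD//.
        by rewrite !exprMn -exprM mulnC le_eqVlt; apply/orP; left; apply/eqP; field.
      rewrite -mulrA mulrCA exprMn -exprM mulnC -mulrA ler_wpM2l//.
      rewrite ler_wpM2l ?exprn_ge0// ler_expR; exact: ler_piMl.
  rewrite ge0_integralD//=; first last.
  - apply/measurable_EFinP; apply: measurable_funD; apply: measurable_funM => //.
    exact: measurable_funX.
  - move=> g _; rewrite -EFinD lee_fin addr_ge0// !mulr_ge0// ?exprn_ge0 ?mulr_ge0 ?expR_ge0//.
  rewrite probability_integral_cst ge0_integralD//=; first last.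
  - by apply/measurable_EFinP; exact: measurable_funM.
  - by move=> g _; rewrite lee_fin !mulr_ge0// ?exprn_ge0 ?mulr_ge0 ?expR_ge0.
  - by apply/measurable_EFinP; apply: measurable_funM => //; exact: measurable_funX.
  - by move=> g _; rewrite lee_fin !mulr_ge0// ?exprn_ge0.
  rewrite !ge0_integralZl//; first last.
  - by rewrite lee_fin !mulr_ge0// exprn_ge0.
  - by apply/measurable_EFinP; exact: measurable_funX.
  - by rewrite lee_fin.
  - by move=> g _; rewrite lee_fin !mulr_ge0// ?exprn_ge0 ?mulr_ge0 ?expR_ge0.
  - exact/measurable_EFinP.
  by rewrite gauss_varE KE -!EFinM -!EFinD lee_fin /kk addrA.
have Qn n : Q th (kk n ^+ (2 ^ n)).
  apply: iter_halving => // x'; apply: le_trans (base _ _) _; first by rewrite mulr_ge0.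
  by rewrite (mulrC (kk n)) (EFinM (cosh _) (kk n)) lee_wpmul2l ?lee_fin//; exact: bnd.
have kkE n : (kk n ^+ (2 ^ n) <= expR (c ^+ 2 / 2 * V + K * r ^+ n))%R.
  apply: (@le_trans _ _ (expR (c ^+ 2 * r ^+ (2 * n) / 2 * V + r ^+ (3 * n) * K) ^+ (2 ^ n))%R).
    by rewrite lerXn2r ?nnegrE ?expR_ge0// /kk -addrA expR_ge1Dx.
  rewrite -expRM_natl ler_expR.
  (* The power 2^n compensates r^(2n) exactly, so the variance survives, while the cubic term keeps
     a factor r^n that tends to 0. *)
  have E2 : (r ^+ (2 * n) * (2 ^ n)%:R = 1)%R.
    by rewrite exprM r2 natrX -exprMn mulVf ?expr1n// pnatr_eq0.
  have E3 : (r ^+ (3 * n) * (2 ^ n)%:R = r ^+ n)%R.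
    by rewrite -(addn1 2) mulnDl mul1n exprD mulrAC E2 mul1r.
  rewrite mulrDr le_eqVlt; apply/orP; left; apply/eqP; congr (_ + _)%R.
    by transitivity (r ^+ (2 * n) * (2 ^ n)%:R * (c ^+ 2 / 2 * V))%R; [field|rewrite E2 mul1r].
  by rewrite mulrA (mulrC _%:R) E3 mulrC.
have fineE : Ecosh th x \is a fin_num.
  rewrite ge0_fin_numE ?integral_ge0// => [|g _]; last by rewrite lee_fin.
  exact: le_lt_trans (Qn 0%N x) (ltry _).
rewrite -/(Ecosh th x) -(fineK fineE) lee_fin.
have cv : (cosh (th * `|x|) * expR (c ^+ 2 / 2 * V + K * r ^+ n) @[n --> \oo] -->
    cosh (th * `|x|) * expR (2 * D ^+ 2 * th ^+ 2 * V))%R.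
  apply: cvgM; first exact: cvg_cst.
  have -> : (2 * D ^+ 2 * th ^+ 2 * V = c ^+ 2 / 2 * V + K * 0)%R by rewrite /c; field.
  apply: (cvg_comp _ expR); last exact: continuous_expR.
  apply: cvgD; first exact: cvg_cst.
  apply: cvgM; first exact: cvg_cst.
  by apply: cvg_expr; rewrite gtr0_norm// r1.
apply: (@ler_cvg_to _ _ _ _ _ _ _ _ (cvg_cst _) cv).
near=> n; rewrite -lee_fin (fineK fineE) (le_trans (Qn n x))// lee_fin mulrC.
by rewrite ler_wpM2l.
Unshelve. all: by end_near. Qed.

End gauss_step.

(** * Supermartingales and Ville's inequality *)

Section freezing.
Context {R : realType} {d : measure_display} {Omega : measurableType d}.
Variable P : probability Omega R.

Lemma measurable_id_sub d' (T : measurableType d') (G : set (set T)) :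
  G `<=` measurable -> measurable_fun [set: T] (id : T -> g_sigma_algebraType G).
Proof.
move=> GM _ Y mY; rewrite setTI preimage_id.
have : <<s G >> `<=` (@measurable _ T) by apply: smallest_sub => //; exact: sigma_algebra_measurable.
exact.
Qed.

Lemma measurable_id_sub_sigma (G G' : set (set Omega)) : G `<=` G' ->
  measurable_fun [set: g_sigma_algebraType G'] (id : g_sigma_algebraType G' -> g_sigma_algebraType G).
Proof.
move=> GG; apply: measurable_id_sub => A GA; exact: sub_sigma_algebra (GG _ GA).
Qed.

(** Stands in for conditional expectation given G. The identity of [Omega], seen as a map into
    [Omega] with the sigma-algebra G, is a random element independent of [gamma]; its joint law with
    [gamma] is therefore a product measure and Tonelli applies. *)
Lemma integral_freezing (G : set (set Omega)) m (gamma : Omega -> m.-tuple (measurableTypeR R))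
    (H : g_sigma_algebraType G * m.-tuple (measurableTypeR R) -> \bar R) :
  sigma_algebra setT G -> G `<=` measurable ->
  measurable_fun [set: Omega] gamma ->
  (forall B, measurable B -> P (gamma @^-1` B) = std_gauss R m B) ->
  (forall E B, G E -> measurable B ->
    P (E `&` gamma @^-1` B) = (P E * P (gamma @^-1` B))%E) ->
  measurable_fun [set: g_sigma_algebraType G * m.-tuple (measurableTypeR R)] H ->
  (forall z, (0 <= H z)%E) ->
  (\int[P]_w H (w, gamma w) = \int[P]_w \int[std_gauss R m]_g H (w, g))%E.
Proof.
move=> sG GM mgamma law ind mH H0.
have mid := measurable_id_sub GM.
pose Xid : {mfun Omega >-> g_sigma_algebraType G} :=
  HB.pack (id : Omega -> g_sigma_algebraType G) (isMeasurableFun.Build _ _ _ _ _ mid).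
pose pr (w : Omega) : g_sigma_algebraType G * m.-tuple (measurableTypeR R) := (w, gamma w).
have mpr : measurable_fun [set: Omega] pr by exact: measurable_fun_pair.
pose Xpr : {mfun Omega >-> (g_sigma_algebraType G * m.-tuple (measurableTypeR R))%type} :=
  HB.pack pr (isMeasurableFun.Build _ _ _ _ _ mpr).
have E : forall A, measurable A ->
    (distribution P Xid \x std_gauss R m)%E A = distribution P Xpr A.
  apply: product_measure_unique => A B mA mB.
  have GA : G A by rewrite -(sigma_algebra_id sG).
  transitivity (P (A `&` gamma @^-1` B)) => //.
  by rewrite ind// law.
transitivity (\int[distribution P Xpr]_z H z)%E.
  by rewrite ge0_integral_distribution.
rewrite (eq_measure_integral (distribution P Xid \x std_gauss R m)%E); last first.
  by move=> A mA _; exact/esym/E.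
rewrite fubini_tonelli1// ge0_integral_distribution//.
- exact: measurable_fun_fubini_tonelli_F.
- by move=> y; exact: integral_ge0.
Qed.

End freezing.

Section ville.
Context {R : realType} {d : measure_display} {Omega : measurableType d}.
Variables (P : probability Omega R) (N : nat) (F : nat -> set (set Omega)).
Hypothesis Ffil : filtration N F.
Variable V : nat -> Omega -> R.
Hypothesis V0 : forall j w, 0 <= V j w.
Hypothesis V1 : forall w, V 0 w = 1.
Hypothesis mV : forall j, (j <= N)%N ->
  measurable_fun [set: g_sigma_algebraType (F j)] (V j : g_sigma_algebraType (F j) -> R).
Hypothesis superV : forall j E, (j < N)%N -> F j E ->
  (\int[P]_(w in E) (V j.+1 w)%:E <= \int[P]_(w in E) (V j w)%:E)%E.

Lemma filtration_le i j : (i <= j)%N -> (j <= N)%N -> F i `<=` F j.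
Proof.
move=> ij; rewrite -(subnKC ij); elim: (j - i)%N => [|k IH]; first by rewrite addn0 => _.
rewrite addnS => kN; apply: subset_trans (IH (ltnW kN)) _.
exact: Ffil.2.
Qed.

Lemma measurable_filtration j : (j <= N)%N -> F j `<=` measurable.
Proof. by move=> jN; exact: (Ffil.1 j jN).2. Qed.

Lemma g_filtrationE j : (j <= N)%N -> <<s F j >> = F j.
Proof. by move=> jN; apply: sigma_algebra_id; exact: (Ffil.1 j jN).1. Qed.

Lemma filtration_measurable_fun j (f : Omega -> R) : (j <= N)%N ->
  measurable_fun [set: g_sigma_algebraType (F j)] (f : g_sigma_algebraType (F j) -> R) ->
  measurable_fun [set: Omega] f.
Proof.
move=> jN mf; exact: (measurableT_comp mf (measurable_id_sub (measurable_filtration jN))).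
Qed.

(** A localized form: on A the process never leaves 1, so A contributes P(A) to the terminal
    integral, and removing it from the initial mass 1 leaves P(~A) on the right. This factor is what
    makes the errors summable over the levels. *)
Lemma ville (c : R) (A E : set Omega) : 1 < c -> measurable A -> measurable E ->
  (forall w j, A w -> (j <= N)%N -> V j w = 1) ->
  (forall w, E w -> exists2 j, (j <= N)%N & c <= V j w) ->
  (c%:E * P E <= P (~` A))%E.
Proof.
move=> c1 mA mE AV EV.
have c0 : 0 <= c by rewrite (le_trans ler01)// ltW.
(* The level [c] has not been reached strictly before time [j]; hence [S 0] is everything, and
   [S j.+1] is already in [F j]. *)
pose S j := [set w | forall i, (i < j)%N -> V i w < c].
have FV j : (j <= N)%N -> F j [set w | V j w < c].
  move=> jN; rewrite -(g_filtrationE jN).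
  have := mV jN measurableT (measurable_itv `]-oo, c[).
  rewrite setTI; congr (<<s _ >> _); apply/seteqP; split=> w/=; by rewrite in_itv.
have SS j : S j.+1 = S j `&` [set w | V j w < c].
  apply/seteqP; split=> w /=.
    by move=> h; split=> [i ij|]; apply: h => //; exact: ltnW.
  by move=> [h1 h2] i; rewrite ltnS leq_eqVlt => /predU1P[->//|]; exact: h1.
have FI j (B C : set Omega) : (j <= N)%N -> F j B -> F j C -> F j (B `&` C).
  move=> jN; rewrite -(g_filtrationE jN) => FB FC.
  exact: (@measurableI _ (g_sigma_algebraType (F j))).
have FS j : (j <= N)%N -> F j (S j.+1).
  elim: j => [|j IH] jN.
    rewrite SS (_ : S 0 = setT) ?setTI; first exact: FV.
    by apply/seteqP; split=> w.
  rewrite SS; apply: (FI) => //; last exact: FV.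
  by apply: (filtration_le (leqnSn j) jN); apply: IH; exact: ltnW.
have mS j : (j <= N.+1)%N -> measurable (S j).
  case: j => [_|j]; first by rewrite (_ : S 0 = setT)//; apply/seteqP; split=> w.
  by rewrite ltnS => jN; apply: (measurable_filtration jN); exact: FS.
have mVO j : (j <= N)%N -> measurable_fun [set: Omega] (fun w => (V j w)%:E).
  by move=> jN; apply/measurable_EFinP; exact: (filtration_measurable_fun jN (mV jN)).
(* Optional stopping by hand: on [U], where the first crossing happens at time [j], the process is
   at least [c], so its integral there pays for the newly crossed mass. *)
have half j : (j <= N)%N ->
   (\int[P]_(w in S j.+1) (V j w)%:E + c%:E * P (~` S j.+1) <=
    \int[P]_(w in S j) (V j w)%:E + c%:E * P (~` S j))%E.
  move=> jN.
  have mSj := mS j (leqW jN); have mSj1 := mS j.+1 jN.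
  pose U := S j `\` S j.+1.
  have mU : measurable U by exact: measurableD.
  have SjE : S j = S j.+1 `|` U by rewrite /U SS setDUK//; exact: subIsetl.
  have dSU : [disjoint S j.+1 & U] by rewrite disj_set2E /U setDE setIA setIAC setICr set0I.
  have -> : (\int[P]_(w in S j) (V j w)%:E =
      \int[P]_(w in S j.+1) (V j w)%:E + \int[P]_(w in U) (V j w)%:E)%E.
    rewrite {1}SjE (@ge0_integral_setU _ _ _ _ _ _ mSj1 mU)//; last first.
    - by move=> w _; rewrite lee_fin.
    - apply: measurable_funTS; exact: mVO.
  rewrite (_ : ~` S j.+1 = ~` S j `|` U); last first.
    rewrite /U SS; apply/seteqP; split=> w /=.
      have [Sw|Sw] := pselect (S j w); last by left.
      by move=> h; right.
    by move=> [h [h1 _]//|[h1 h2]//].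
  rewrite measureU//; [|exact: measurableC|]; last first.
    by rewrite /U setDE setIA setICl set0I.
  rewrite muleDr//; last by rewrite ge0_adde_def// inE ?measure_ge0.
  rewrite -addeA; apply: leeD => //; rewrite addeC; apply: leeD => //.
  rewrite -integral_cst//; apply: ge0_le_integral => //.
  - by apply: measurable_funTS; exact: mVO.
  - move=> w; rewrite /U SS => -[Sw] /not_andP[//|]/= /negP.
    by rewrite lee_fin -leNgt.
have main j : (j <= N)%N ->
   (\int[P]_(w in S j) (V j w)%:E + c%:E * P (~` S j) <= 1)%E.
  elim: j => [_|j IH jN].
    rewrite (_ : S 0 = setT); last by apply/seteqP; split=> w.
    rewrite setCT measure0 mule0 adde0; under eq_integral do rewrite V1.
    by rewrite probability_integral_cst.
  apply: le_trans (IH (ltnW jN)); apply: le_trans (half j (ltnW jN)).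
  by apply: leeD => //; apply: superV => //; exact: (FS _ (ltnW jN)).
have := le_trans (half N (leqnn N)) (main N (leqnn N)).
have ES : E `<=` ~` S N.+1.
  by move=> w /EV[j jN cV] /(_ j jN); rewrite ltNge cV.
have AS : A `<=` S N.+1 by move=> w Aw i iN; rewrite AV.
have mSN := mS N.+1 (leqnn _).
have PA : (P A <= \int[P]_(w in S N.+1) (V N w)%:E)%E.
  apply: (@le_trans _ _ (\int[P]_(w in A) (V N w)%:E)%E).
    under eq_integral => w /[!inE] Aw do rewrite (AV w N Aw (leqnn N)).
    by rewrite integral_cst// mul1e.
  apply: ge0_subset_integral => //; first by apply: measurable_funTS; exact: mVO.
  by move=> w _; rewrite lee_fin.
move=> h; rewrite (probability_setC P mA) leeBrDl//; last exact: fin_num_measure.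
apply: le_trans h; apply: leeD => //; rewrite lee_wpmul2l ?lee_fin//.
by apply: le_measure => //; rewrite inE//; exact: measurableC.
Qed.

End ville.

Lemma nneseries_le {R : realType} (u : nat -> \bar R) (M : \bar R) :
  (forall n, 0 <= u n)%E -> (forall n, \sum_(0 <= i < n) u i <= M)%E ->
  (\sum_(i <oo) u i <= M)%E.
Proof.
by move=> u0 uM; apply: lime_le; [exact: is_cvg_nneseries|exact: nearW].
Qed.

Lemma measurable_bigmaxr {R : realType} d (T : measurableType d) (I : Type) (r : seq I)
    (f : I -> T -> R) : (forall i, measurable_fun [set: T] (f i)) ->
  measurable_fun [set: T] (fun w => \big[Num.max/0]_(i <- r) f i w).
Proof.
move=> mf; elim: r => [|i r IH]; first by under eq_fun do rewrite big_nil; exact: measurable_cst.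
by under eq_fun do rewrite big_cons; exact: measurable_maxr.
Qed.

(** * Predictable sums *)

Section process.
Context {R : realType} {X : normedModType R} {d : measure_display} {Omega : measurableType d}.
Variables (s : nat -> X) (sX : forall x e, 0 < e -> exists n, `|x - s n| < e).
Variables (P : probability Omega R) (N : nat) (F : nat -> set (set Omega)) (m : nat -> nat).
Variable gamma : forall i, Omega -> (m i).-tuple (measurableTypeR R).
Variable B : forall i, Omega -> {linear 'cV[R]_(m i) -> X}.
Hypothesis Ffil : filtration N F.
Hypothesis Hgauss : forall i, (i < N)%N -> forall A, measurable A ->
    P (gamma i @^-1` A) = std_gauss R (m i) A.
Hypothesis Hindep : forall i, (i < N)%N -> forall E A, F i E -> measurable A ->
    P (E `&` gamma i @^-1` A) = (P E * P (gamma i @^-1` A))%E.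
Hypothesis Hadapt : forall i, (i < N)%N ->
  measurable_fun [set: g_sigma_algebraType (F i.+1)]
    (gamma i : g_sigma_algebraType (F i.+1) -> _).
Hypothesis Hpred : forall i, (i < N)%N -> forall v,
  norm_measurable (fun w : g_sigma_algebraType (F i) => B i w v).

Definition step_var i w : R := gauss_var (B i w).
Definition cum_var j w : R := \sum_(i < j) step_var i w.

Lemma step_var_ge0 i w : 0 <= step_var i w.
Proof. exact: gauss_var_ge0. Qed.

Lemma measurable_filtration_le i j (f : Omega -> R) : (i <= j)%N -> (j <= N)%N ->
  measurable_fun [set: g_sigma_algebraType (F i)] (f : g_sigma_algebraType (F i) -> R) ->
  measurable_fun [set: g_sigma_algebraType (F j)] (f : g_sigma_algebraType (F j) -> R).
Proof.
move=> ij jN mf.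
exact: (measurableT_comp mf (measurable_id_sub_sigma (filtration_le Ffil ij jN))).
Qed.

Lemma measurable_step_var i : (i < N)%N ->
  measurable_fun [set: g_sigma_algebraType (F i)] (step_var i : g_sigma_algebraType (F i) -> R).
Proof.
move=> iN; apply: (measurableT_comp (f := fine)) => //.
apply: (@measurable_fun_fubini_tonelli_F _ _ (g_sigma_algebraType (F i)) _ _ _
  (fun w : g_sigma_algebraType (F i) * (m i).-tuple (measurableTypeR R) =>
     (`|B i w.1 (col_of_tuple w.2)| ^+ 2)%:E)) => //.
apply/measurable_EFinP; apply: measurable_funX; apply: norm_measurable_norm.
apply: (norm_measurable_linear sX (B := fun w : g_sigma_algebraType (F i) * (m i).-tuple (measurableTypeR R) => B i w.1)) => // v.
exact: (norm_measurable_comp measurable_fst (Hpred iN v)).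
Qed.

(** The index shift matters: increment j has its variance determined by [B j], so the square
    function including increment j is known at time j. The assignment of increments to levels relies
    on this. *)
Lemma measurable_cum_var j : (j < N)%N ->
  measurable_fun [set: g_sigma_algebraType (F j)] (cum_var j.+1 : g_sigma_algebraType (F j) -> R).
Proof.
move=> jN.
have -> : cum_var j.+1 = fun w => \sum_(i <- index_enum 'I_j.+1) (step_var i w) by [].
apply: measurable_sum => i.
apply: (@measurable_filtration_le i j) => //; first by rewrite -ltnS.
  exact: ltnW.
by apply: measurable_step_var; rewrite (leq_ltn_trans _ jN)// -ltnS.
Qed.

(** * Sums over a predictable random set of increments *)

Section thinned.
Variable e : nat -> Omega -> R.
Hypothesis e01 : forall i w, e i w = 0 \/ e i w = 1.
Hypothesis me : forall i, (i < N)%N ->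
  measurable_fun [set: g_sigma_algebraType (F i)] (e i : g_sigma_algebraType (F i) -> R).

Definition thin_sum j w : X := \sum_(i < j) e i w *: B i w (col_of_tuple (gamma i w)).
Definition thin_var j w : R := \sum_(i < j) e i w * step_var i w.

Lemma e_ge0 i w : 0 <= e i w.
Proof. by case: (e01 i w) => ->. Qed.

Lemma norm_measurable_thin_sum j : (j <= N)%N ->
  norm_measurable (thin_sum j : g_sigma_algebraType (F j) -> X).
Proof.
move=> jN.
have -> : thin_sum j = fun w => \sum_(i <- index_enum 'I_j)
   (e i w *: B i w (col_of_tuple (gamma i w))) by [].
apply: (norm_measurable_sum sX) => i; have iN : (i < N)%N by rewrite (leq_trans _ jN).
apply: (norm_measurableZ sX).
  by apply: (@measurable_filtration_le i j _ _ jN (me iN)); exact: ltnW.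
apply: (norm_measurable_linear sX (B := fun w : g_sigma_algebraType (F j) => B i w)) => [v|].
  have ij : (i <= j)%N by exact: ltnW.
  exact: (norm_measurable_comp (measurable_id_sub_sigma (filtration_le Ffil ij jN)) (Hpred iN v)).
exact: (measurableT_comp (Hadapt iN) (measurable_id_sub_sigma (filtration_le Ffil (ltn_ord i) jN))).
Qed.

Lemma measurable_thin_sum j : (j <= N)%N ->
  measurable_fun [set: Omega] (fun w => `|thin_sum j w|).
Proof.
move=> jN; apply: (filtration_measurable_fun Ffil jN).
exact: (norm_measurable_norm (norm_measurable_thin_sum jN)).
Qed.

Lemma measurable_thin_var j : (j <= N)%N ->
  measurable_fun [set: g_sigma_algebraType (F j)] (thin_var j : g_sigma_algebraType (F j) -> R).
Proof.
move=> jN.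
have -> : thin_var j = fun w => \sum_(i <- index_enum 'I_j) (e i w * step_var i w) by [].
apply: measurable_sum => i; have iN : (i < N)%N by rewrite (leq_trans _ jN).
have ij : (i <= j)%N by exact: ltnW.
apply: measurable_funM; apply: (measurable_filtration_le ij jN); [exact: me|exact: measurable_step_var].
Qed.

Variable D : R.
Hypotheses (D1 : 1 <= D) (sm : smooth2 X D).

Definition exp_mart th j w : R :=
  cosh (th * `|thin_sum j w|) * expR (- (2 * D ^+ 2 * th ^+ 2) * thin_var j w).

(** Freezing the past at time j leaves one Gaussian integral. An increment that is not selected
    changes nothing, and for a selected one the compensator is exactly the exponent of
    [gauss_cosh_le]. *)
Lemma exp_mart_super th j E : 0 <= th -> (j < N)%N -> F j E ->
  (\int[P]_(w in E) (exp_mart th j.+1 w)%:E <= \int[P]_(w in E) (exp_mart th j w)%:E)%E.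
Proof.
move=> th0 jN FE.
have jN' : (j <= N)%N := ltnW jN.
set k := 2 * D ^+ 2 * th ^+ 2.
have mE : measurable E by exact: (measurable_filtration Ffil jN').
have mEF : measurable (E : set (g_sigma_algebraType (F j))).
  by apply: sub_sigma_algebra.
pose OF := g_sigma_algebraType (F j).
pose T2 := (m j).-tuple (measurableTypeR R).
pose H (z : OF * T2) : \bar R := ((\1_E z.1 * expR (- k * (thin_var j z.1 + e j z.1 * step_var j z.1))) *
   cosh (th * `|thin_sum j z.1 + e j z.1 *: B j z.1 (col_of_tuple z.2)|))%:E.
have mtv : measurable_fun [set: OF] (thin_var j : OF -> R) by exact: measurable_thin_var.
have mH : measurable_fun [set: OF * T2] H.
  apply/measurable_EFinP; apply: measurable_funM.
    apply: measurable_funM.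
      by apply: (measurableT_comp (f := (\1_E : OF -> R))) => //; exact: measurable_indic.
    apply: measurableT_comp => //; apply: measurable_funM => //.
    apply: (measurableT_comp (f := fun w : OF => thin_var j w + e j w * step_var j w)) => //.
    apply: measurable_funD => //; apply: measurable_funM; [exact: me|exact: measurable_step_var].
  apply: measurableT_comp; first exact: measurable_cosh.
  apply: measurable_funM => //; apply: norm_measurable_norm.
  apply: (norm_measurableD sX).
    exact: (norm_measurable_comp measurable_fst (norm_measurable_thin_sum jN')).
  apply: (norm_measurableZ sX); first exact: (measurableT_comp (me jN) measurable_fst).
  apply: (norm_measurable_linear sX (B := fun z : OF * T2 => B j z.1)) => // v.
  exact: (norm_measurable_comp measurable_fst (Hpred jN v)).
have H0 z : (0 <= H z)%E.
  by rewrite lee_fin !mulr_ge0 ?expR_ge0 ?(ltW (cosh_gt0 _)).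
have sFj : sigma_algebra setT (F j) := (Ffil.1 j jN').1.
have mgamma : measurable_fun [set: Omega] (gamma j).
  have := Hadapt jN.
  by move=> /measurableT_comp; apply; exact: (measurable_id_sub (measurable_filtration Ffil jN)).
have frz := integral_freezing sFj (measurable_filtration Ffil jN') mgamma (Hgauss jN) (Hindep jN) mH H0.
have -> : (\int[P]_(w in E) (exp_mart th j.+1 w)%:E = \int[P]_w H (w, gamma j w))%E.
  rewrite integral_mkcond; apply: eq_integral => w _; rewrite patchE /H/= indicE.
  case: ifPn => wE; last by rewrite !mul0r.
  rewrite mul1r /exp_mart /thin_sum /thin_var !big_ord_recr/=.
  by rewrite mulrC.
rewrite frz.
have -> : (\int[P]_(w in E) (exp_mart th j w)%:E =
   \int[P]_w (\1_E w * exp_mart th j w)%:E)%E.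
  rewrite integral_mkcond; apply: eq_integral => w _; rewrite patchE indicE.
  by case: ifPn => wE; rewrite ?wE ?(negbTE wE) ?mul1r ?mul0r.
have mI : measurable_fun [set: OF] (fun w : OF => \int[std_gauss R (m j)]_g H (w, g))%E.
  exact: measurable_fun_fubini_tonelli_F.
apply: ge0_le_integral => //.
- by move=> w _; exact: integral_ge0.
- exact: (measurableT_comp mI (measurable_id_sub (measurable_filtration Ffil jN'))).
- apply/measurable_EFinP; apply: measurable_funM; first exact: measurable_indic.
  apply: measurable_funM.
    apply: measurableT_comp; first exact: measurable_cosh.
    by apply: measurable_funM => //; exact: measurable_thin_sum.
  apply: measurableT_comp => //; apply: measurable_funM => //.
  exact: (filtration_measurable_fun Ffil jN').
move=> w _; rewrite /H/=.
under eq_integral do rewrite EFinM.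
rewrite ge0_integralZl//; first last.
- by move=> g _; rewrite lee_fin (ltW (cosh_gt0 _)).
- apply/measurable_EFinP; apply: measurableT_comp; first exact: measurable_cosh.
  apply: measurable_funM => //; apply: norm_measurable_norm.
  apply: (norm_measurableD sX); first exact: norm_measurable_cst.
  apply: (norm_measurableZ sX) => //.
  apply: (norm_measurable_linear sX (B := fun=> B j w)) => // v; exact: norm_measurable_cst.
rewrite (EFinM (\1_E w) (expR _)) -muleA.
rewrite (EFinM (\1_E w) (exp_mart th j w)) lee_wpmul2l ?lee_fin//.
have -> : exp_mart th j w = expR (- k * (thin_var j w + e j w * step_var j w)) *
   (cosh (th * `|thin_sum j w|) * expR (k * (e j w * step_var j w))).
  rewrite mulrCA -expRD /exp_mart -/k; congr (_ * expR _); ring.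
rewrite (EFinM (expR _) (_ * _)) lee_wpmul2l ?lee_fin ?expR_ge0//.
have [->|->] := e01 j w.
  rewrite mul0r mulr0 expR0 mulr1.
  under eq_integral do rewrite scale0r addr0.
  by rewrite probability_integral_cst.
rewrite mul1r; under eq_integral do rewrite scale1r.
exact: (gauss_cosh_le sX).
Qed.

Definition thin_max w : R := \big[Num.max/0]_(j < N.+1) `|thin_sum j w|.

Lemma measurable_thin_max : measurable_fun [set: Omega] thin_max.
Proof.
apply: measurable_bigmaxr => j; apply: measurable_thin_sum; by rewrite -ltnS.
Qed.

Lemma thin_sum0 w j : (forall i, (i < N)%N -> e i w = 0) -> (j <= N)%N -> thin_sum j w = 0.
Proof.
by move=> ew jN; rewrite /thin_sum big1// => i _; rewrite ew ?scale0r// (leq_trans _ jN).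
Qed.

Lemma thin_tail (rho x : R) (A : set Omega) : 0 < rho -> 4 <= x -> measurable A ->
  (forall w, thin_var N w <= rho ^+ 2) ->
  (forall w i, A w -> (i < N)%N -> e i w = 0) ->
  (P [set w | (x * (D * rho) < thin_max w)%R] <= (2 * expR (- (x ^+ 2 / 8)))%:E * P (~` A))%E.
Proof.
move=> rho0 x4 mA vrho eA.
have D0 : 0 < D by rewrite (lt_le_trans ltr01).
(* The minimizer of 2 D^2 th^2 rho^2 - th x D rho, with minimum -x^2 / 8. *)
pose th := x / (4 * (D * rho)).
have th0 : 0 <= th by rewrite divr_ge0 ?mulr_ge0// ?ltW//; lra.
(* The half comes from exp u <= 2 cosh u, and [4 <= x] ensures 1 < c as [ville] requires. *)
pose c := expR (x ^+ 2 / 8) / 2.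
have c1 : 1 < c.
  rewrite /c ltr_pdivlMr// mul1r.
  have := expR_ge1Dx (x ^+ 2 / 8); have : 16 <= x ^+ 2 by nra.
  by lra.
have tv j w : (j <= N)%N -> thin_var j w <= rho ^+ 2.
  move=> jN; apply: le_trans (vrho w); rewrite /thin_var.
  rewrite (big_ord_widen N (fun i => e i w * step_var i w))// big_mkcond/=.
  apply: ler_sum => i _; case: ifP => // _; rewrite mulr_ge0 ?e_ge0 ?step_var_ge0//.
have mM := measurable_thin_max.
have mE : measurable [set w | x * (D * rho) < thin_max w].
  have := mM measurableT _ (measurable_itv `]x * (D * rho), +oo[).
  by rewrite setTI; congr measurable; apply/seteqP; split=> w/=; rewrite in_itv/= andbT.
have := @ville _ _ _ P N F Ffil (exp_mart th) _ _ _ _ c A _ c1 mA mE _ _.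
move=> /(_ _)/(_ _)/(_ _)/(_ _)/(_ _)/(_ _).
have -> : (2 * expR (- (x ^+ 2 / 8)))%:E = (c^-1)%:E.
  by rewrite /c invf_div -expRN.
move=> h.
have c0 : 0 < c by rewrite (lt_trans ltr01).
rewrite -(@lee_pmul2l _ c%:E) ?lte_fin// muleA -EFinM mulfV ?gt_eqF// mul1e.
apply: h.
- by move=> j w; rewrite mulr_ge0 ?expR_ge0 ?(ltW (cosh_gt0 _)).
- by move=> w; rewrite /exp_mart /thin_sum /thin_var !big_ord0 normr0 !mulr0 cosh0 expR0 mulr1.
- move=> j jN; apply: measurable_funM.
    apply: measurableT_comp; first exact: measurable_cosh.
    apply: measurable_funM => //; exact: (norm_measurable_norm (norm_measurable_thin_sum jN)).
  apply: measurableT_comp => //; apply: measurable_funM => //; exact: measurable_thin_var.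
- by move=> j E jN FE; exact: exp_mart_super.
- move=> w j Aw jN; rewrite /exp_mart thin_sum0//; last by move=> i; exact: eA.
  rewrite /thin_var big1 ?normr0 ?mulr0 ?cosh0 ?expR0 ?mulr1// => i _.
  by rewrite eA ?mul0r// (leq_trans _ jN).
- move=> w /= Mw.
  have [j jN hj] : exists2 j, (j <= N)%N & x * (D * rho) < `|thin_sum j w|.
    apply: contrapT => hN; move: Mw; apply/negP; rewrite -leNgt.
    apply: bigmax_le => [|j _]; first by rewrite !mulr_ge0 ?ltW//; lra.
    rewrite leNgt; apply/negP => hj; apply: hN; exists j => //; by rewrite -ltnS.
  exists j => //; rewrite /exp_mart /c ler_pdivrMr//.
  apply: (@le_trans _ _ (expR (th * `|thin_sum j w|) * expR (- (2 * D ^+ 2 * th ^+ 2) * thin_var j w))); last first.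
    have := expR_le_cosh (th * `|thin_sum j w|).
    have := expR_ge0 (- (2 * D ^+ 2 * th ^+ 2) * thin_var j w).
    set b := expR (- _ * _); set a := expR _; set C := cosh _; nra.
  rewrite -expRD ler_expR.
  have e1 : th * (x * (D * rho)) = x ^+ 2 / 4.
    by rewrite /th; field; rewrite !gt_eqF.
  have e2 : 2 * D ^+ 2 * th ^+ 2 * rho ^+ 2 = x ^+ 2 / 8.
    by rewrite /th; field; rewrite !gt_eqF.
  have h1 : th * (x * (D * rho)) <= th * `|thin_sum j w| by rewrite ler_wpM2l// ltW.
  have h2 : 2 * D ^+ 2 * th ^+ 2 * thin_var j w <= 2 * D ^+ 2 * th ^+ 2 * rho ^+ 2.
    apply: ler_wpM2l; last exact: tv.
    by rewrite mulr_ge0 ?sqr_ge0// mulr_ge0 ?sqr_ge0.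
  rewrite mulNr; lra.
Qed.

Lemma thin_max0 w : (forall i, (i < N)%N -> e i w = 0) -> thin_max w = 0.
Proof.
move=> ew; apply/eqP; rewrite eq_le; apply/andP; split.
  by apply: bigmax_le => // j _; rewrite thin_sum0 ?normr0// -ltnS.
exact: bigmax_ge_id.
Qed.

(** [W] counts, in units of b = D rho, how many thresholds (x + n) b are exceeded: if k is the least
    integer with [thin_max] <= (x + k) b, the first k indicators equal 1. On A the maximum is 0, so
    the main term can carry the indicator of the complement. *)
Lemma thin_max_excess (rho x : R) (A : set Omega) : 0 < rho -> 4 <= x -> measurable A ->
  (forall w, thin_var N w <= rho ^+ 2) ->
  (forall w i, A w -> (i < N)%N -> e i w = 0) ->
  exists W : Omega -> \bar R, [/\ measurable_fun [set: Omega] W, (forall w, 0 <= W w)%E,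
    (forall w, (thin_max w)%:E <= (x * (D * rho) * \1_(~` A) w)%:E + W w)%E &
    (\int[P]_w W w <= (4 * (D * rho) * expR (- (x ^+ 2 / 8)))%:E * P (~` A))%E].
Proof.
move=> rho0 x4 mA vrho eA.
set b := D * rho.
have b0 : 0 < b by rewrite mulr_gt0// (lt_le_trans ltr01).
pose H n := [set w | (x + n%:R) * b < thin_max w].
have mH n : measurable (H n).
  have := measurable_thin_max measurableT (measurable_itv `](x + n%:R) * b, +oo[).
  by rewrite setTI; congr measurable; apply/seteqP; split=> w/=; rewrite in_itv/= andbT.
have mHb n : measurable_fun [set: Omega] (fun w => (b * \1_(H n) w)%:E).
  by apply/measurable_EFinP; apply: measurable_funM => //; exact: measurable_indic.
have Hb0 n w : (0 <= (b * \1_(H n) w)%:E)%E by rewrite lee_fin mulr_ge0 ?(ltW b0).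
exists (fun w => \sum_(n <oo) (b * \1_(H n) w)%:E)%E; split.
- by apply: ge0_emeasurable_sum => // k w _ _.
- by move=> w; apply: nneseries_ge0.
- move=> w; rewrite indicE in_setC; have [Aw|Aw] := boolP (w \in A).
    rewrite mulr0 add0e thin_max0; last by move=> i; apply: eA; rewrite inE in Aw.
    by apply: nneseries_ge0.
  rewrite mulr1.
  have exk : exists k, thin_max w <= (x + k%:R) * b.
    exists (Num.bound (thin_max w / b)); rewrite -ler_pdivrMr//.
    apply: (@le_trans _ _ (Num.bound (thin_max w / b))%:R); last by rewrite lerDr; lra.
    apply/ltW/archi_boundP; rewrite divr_ge0 ?(ltW b0)//; exact: bigmax_ge_id.
  case: (ex_minnP exk) => k Mk kmin.
  apply: (@le_trans _ _ ((x * b)%:E + \sum_(0 <= n < k) (b * \1_(H n) w)%:E)%E); last first.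
    by apply: leeD => //; apply: nneseries_lim_ge.
  rewrite (eq_big_nat _ _ (F2 := fun=> b%:E)); last first.
    move=> n /andP[_ nk]; rewrite indicE mem_set ?mulr1// /H/= ltNge.
    by apply/negP => /kmin; rewrite leqNgt nk.
  rewrite sumEFin -EFinD lee_fin sumr_const_nat subn0; apply: le_trans Mk _.
  by rewrite mulrDl mulr_natl.
rewrite integral_nneseries//.
have pfin : P (~` A) \is a fin_num by rewrite fin_num_measure//; exact: measurableC.
set E := expR _; set p := fine (P (~` A)).
have p0 : 0 <= p by rewrite fine_ge0.
have E0 : 0 < E by exact: expR_gt0.
apply: nneseries_le => [n|k]; first by apply: integral_ge0 => w _.
have term n : (\int[P]_w (b * \1_(H n) w)%:E <= (2 * b * E * p * 2^-1 ^+ n)%:E)%E.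
  under eq_integral do rewrite EFinM.
  rewrite ge0_integralZl//; last 2 first.
  - by apply/measurable_EFinP; exact: measurable_indic.
  - by rewrite lee_fin ltW.
  rewrite integral_indic// setIT.
  have xn4 : 4 <= x + n%:R by have : 0 <= n%:R :> R by []; lra.
  apply: le_trans (_ : (b%:E * ((2 * expR (- ((x + n%:R) ^+ 2 / 8)))%:E * P (~` A)) <= _)%E).
    rewrite lee_wpmul2l ?lee_fin ?(ltW b0)//; exact: (thin_tail rho0 xn4 mA vrho eA).
  rewrite -(fineK pfin) -!EFinM lee_fin -/p.
  (* For x >= 4 one has (x + n)^2 / 8 >= x^2 / 8 + n, and exp(-n) <= 2^(-n). The geometric series
     doubles the 2 of [thin_tail] into the 4 of the conclusion. *)
  have h1 : expR (- ((x + n%:R) ^+ 2 / 8)) <= E * 2^-1 ^+ n.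
    apply: (@le_trans _ _ (E * expR (- n%:R))).
      rewrite -expRD ler_expR; have : 0 <= n%:R :> R by []; nra.
    rewrite ler_wpM2l ?(ltW E0)// expRN -[n%:R]mulr1 expRM_natl exprVn lef_pV2 ?posrE ?exprn_gt0 ?expR_gt0//.
    by rewrite lerXn2r ?nnegrE ?expR_ge0//; have := expR_ge1Dx (1 : R); lra.
  apply: (@le_trans _ _ (b * (2 * (E * 2^-1 ^+ n) * p))).
    by rewrite ler_wpM2l ?(ltW b0)// ler_wpM2r// ler_wpM2l.
  by rewrite le_eqVlt; apply/orP; left; apply/eqP; ring.
apply: le_trans (_ : (\sum_(0 <= n < k) (2 * b * E * p * 2^-1 ^+ n)%:E <= _)%E).
  by apply: lee_sum => n _.
rewrite -(fineK pfin) -EFinM sumEFin lee_fin -/p.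
have -> : \sum_(0 <= n < k) 2 * b * E * p * 2^-1 ^+ n = 4 * b * E * p * (1 - 2^-1 ^+ k).
  elim: k => [|k IH]; first by rewrite big_geq// expr0; ring.
  by rewrite big_nat_recr//= IH exprS; field.
have : 0 <= 4 * b * E * p by rewrite mulr_ge0// mulr_ge0 ?(ltW E0)// mulr_ge0 ?(ltW b0).
have : 0 <= 2^-1 ^+ k :> R by rewrite exprn_ge0.
set u := _ ^+ k; set v := 4 * _ * _ * _; nra.
Qed.

End thinned.

(** Lower ends are excluded from their levels; the value -1 puts zero variance into level 0. *)
Definition level_lo (a : R) (l : nat) : R := if l is k.+1 then (2 ^+ k * a) ^+ 2 else -1.

(** The sum is geometric and dominated by its last active level. If that level is k + 1, then 2^k a
    < sqrt v and the sum is at most 2 * 2^(k+1) a < 4 sqrt v; if only level 0 is active, the sum is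
    at most a. *)
Lemma level_sum (a v : R) K : 0 < a -> 0 <= v ->
  \sum_(0 <= l < K) 2 ^+ l * a * ((level_lo a l < v)%R)%:R <= a + 4 * Num.sqrt v.
Proof.
move=> a0 v0.
have s0 : 0 <= Num.sqrt v by exact: sqrtr_ge0.
have geo k : \sum_(0 <= l < k) 2 ^+ l * a * ((level_lo a l < v)%R)%:R <= 2 ^+ k * a.
  elim: k => [|k IH]; first by rewrite big_geq// expr0 mul1r ltW.
  rewrite big_nat_recr//= exprS.
  have : 2 ^+ k * a * ((level_lo a k < v)%R)%:R <= 2 ^+ k * a.
    by rewrite ler_piMr ?mulr_ge0 ?exprn_ge0 ?(ltW a0)// lern1 leq_b1.
  by move: IH; lra.
elim: K => [|K IH]; first by rewrite big_geq// addr_ge0 ?(ltW a0)// mulr_ge0.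
rewrite big_nat_recr//=; have [lt|ge] := ltP (level_lo a K) v; last by rewrite mulr0 addr0.
case: K lt IH => [|k] lt IH.
  by rewrite big_geq// add0r expr0 mul1r mulr1 lerDl mulr_ge0.
rewrite mulr1; apply: le_trans (lerD (geo k.+1) (lexx _)) _.
have h : 2 ^+ k * a < Num.sqrt v.
  have ka0 : 0 <= 2 ^+ k * a by rewrite mulr_ge0 ?exprn_ge0 ?(ltW a0).
  by rewrite -[ltLHS]ger0_norm// -sqrtr_sqr ltr_sqrt// (le_lt_trans _ lt)// sqr_ge0.
by rewrite exprS; lra.
Qed.

Lemma cum_var_ge0 j w : 0 <= cum_var j w.
Proof. by apply: sumr_ge0 => i _; exact: step_var_ge0. Qed.

Lemma cum_var_le i j w : (i <= j)%N -> cum_var i w <= cum_var j w.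
Proof.
move=> ij; rewrite /cum_var (big_ord_widen j (fun i => step_var i w))// big_mkcond/=.
by apply: ler_sum => k _; case: ifP => // _; exact: step_var_ge0.
Qed.

Variable D : R.
Hypotheses (D1 : 1 <= D) (sm : smooth2 X D).

Definition pred_sum j w : X := \sum_(i < j) B i w (col_of_tuple (gamma i w)).
Definition pred_max w : R := \big[Num.max/0]_(j < N.+1) `|pred_sum j w|.

Lemma measurable_cum_varN : measurable_fun [set: Omega] (cum_var N).
Proof.
have [N0|N0] := posnP N.
  rewrite N0 (_ : cum_var 0 = cst 0); first exact: measurable_cst.
  by apply/funext => w; rewrite /cum_var big_ord0.
have NN : (N.-1 < N)%N by rewrite prednK.
have := filtration_measurable_fun Ffil (ltnW NN) (measurable_cum_var NN).
by rewrite prednK.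
Qed.

(* Increment i is assigned to the level l with level_lo l < cum_var i.+1 <= (2^l a)^2;
   the assignment is predictable and level l has total variance at most (2^l a)^2. *)
Lemma pred_max_excess (a x : R) : 0 < a -> 4 <= x ->
  (\int[P]_w (Num.sqrt (cum_var N w))%:E <= a%:E)%E ->
  exists W : Omega -> \bar R, [/\ measurable_fun [set: Omega] W, (forall w, 0 <= W w)%E,
    (forall w, (pred_max w)%:E <= (4 * x * D * (Num.sqrt (cum_var N w) + a))%:E + W w)%E &
    (\int[P]_w W w <= (20 * D * a * expR (- (x ^+ 2 / 8)))%:E)%E].
Proof.
move=> a0 x4 Sa.
have D0 : 0 < D by rewrite (lt_le_trans ltr01).
pose rho l := 2 ^+ l * a.
have rho0 l : 0 < rho l by rewrite mulr_gt0 ?exprn_gt0.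
pose e l i w : R := ((level_lo a l < cum_var i.+1 w <= rho l ^+ 2)%R)%:R.
have e01 l i w : e l i w = 0 \/ e l i w = 1 by rewrite /e; case: (_ && _); [right|left].
have me l i : (i < N)%N ->
    measurable_fun [set: g_sigma_algebraType (F i)] (e l i : g_sigma_algebraType (F i) -> R).
  move=> iN; pose U := (cum_var i.+1 : g_sigma_algebraType (F i) -> R) @^-1` `]level_lo a l, rho l ^+ 2]%classic.
  rewrite (_ : e l i = \1_U); last first.
    apply/funext => w; rewrite indicE /e; congr (nat_of_bool _)%:R.
    by apply/idP/idP; rewrite inE /U/= in_itv.
  apply: measurable_indic; rewrite -[X in measurable X]setTI.
  by apply: (measurable_cum_var iN) => //; exact: measurable_itv.
pose A l := [set w | cum_var N w <= level_lo a l].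
have mA l : measurable (A l).
  have := measurable_cum_varN measurableT (measurable_itv `]-oo, level_lo a l]).
  by rewrite setTI; congr measurable; apply/seteqP; split=> w/=; rewrite in_itv.
have eA l w i : A l w -> (i < N)%N -> e l i w = 0.
  rewrite /A/= => Aw iN; rewrite /e ltNge (le_trans (cum_var_le w iN) Aw)//.
have vrho l w : thin_var (e l) N w <= rho l ^+ 2.
  (* The two bounds are proved together: when increment j is selected, the new thinned variance is
     at most the new cumulative one, which is at most rho^2 by the choice of the level. *)
  suff h j : thin_var (e l) j w <= cum_var j w /\ thin_var (e l) j w <= rho l ^+ 2 by exact: (h N).2.
  elim: j => [|j [IH1 IH2]].
    by rewrite /thin_var /cum_var !big_ord0; split => //; exact: sqr_ge0.
  have cS : cum_var j.+1 w = cum_var j w + step_var j w by rewrite /cum_var big_ord_recr.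
  have tS : thin_var (e l) j.+1 w = thin_var (e l) j w + e l j w * step_var j w.
    by rewrite /thin_var big_ord_recr.
  rewrite tS cS; have q0 := step_var_ge0 j w.
  have [hb|hb] := boolP (level_lo a l < cum_var j.+1 w <= rho l ^+ 2); last first.
    by rewrite /e (negbTE hb) mul0r addr0; split=> //; lra.
  by rewrite /e hb mul1r; case/andP: hb => _; rewrite cS => ?; split; lra.
have /choice[W HW] := fun l => thin_max_excess (e01 l) (me l) D1 sm (rho0 l) x4 (mA l) (vrho l) (eA l).
have G l w : \1_(~` A l) w = ((level_lo a l < cum_var N w)%R)%:R :> R.
  rewrite indicE; congr (nat_of_bool _)%:R; rewrite in_setC ltNge; congr (~~ _).
  by apply/idP/idP; rewrite inE.
exists (fun w => \sum_(l <oo) W l w)%E; split.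
- by apply: ge0_emeasurable_sum => [l w _ _|l _]; have [] := HW l.
- by move=> w; apply: nneseries_ge0 => l _ _; have [] := HW l.
- move=> w.
  have W0 l : (0 <= W l w)%E by have [] := HW l.
  have t0 l : (0 <= (x * (D * rho l) * \1_(~` A l) w)%:E)%E.
    by rewrite lee_fin !mulr_ge0 ?(ltW D0) ?(ltW (rho0 l))//; lra.
  have [L hL] : exists L, cum_var N w <= rho L ^+ 2.
    pose L := Num.bound (Num.sqrt (cum_var N w) / a); exists L.
    have h : Num.sqrt (cum_var N w) / a < L%:R by apply/archi_boundP; rewrite divr_ge0 ?sqrtr_ge0 ?ltW.
    rewrite -[leLHS]sqr_sqrtr ?cum_var_ge0// lerXn2r ?nnegrE ?sqrtr_ge0 ?(ltW (rho0 L))//.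
    rewrite /rho -ler_pdivrMr// (le_trans (ltW h))// -natrX ler_nat ltnW// ltn_expl//.
  (* Up to the level L that contains the terminal variance, the half-open levels form a partition,
     so every increment belongs to exactly one of them. *)
  have split_sum j : (j <= N)%N -> pred_sum j w = \sum_(0 <= l < L.+1) thin_sum (e l) j w.
    move=> jN; rewrite /thin_sum exchange_big/=; apply: eq_bigr => i _.
    have iN : (i < N)%N by rewrite (leq_trans _ jN).
    rewrite -scaler_suml.
    have -> : \sum_(0 <= l < L.+1) e l i w = 1; last by rewrite scale1r.
    have hi := le_trans (cum_var_le w iN) hL.
    have v0 : -1 < cum_var i.+1 w by rewrite (lt_le_trans _ (cum_var_ge0 _ _))// ltrN10.
    elim: L {hL} hi => [|k IH] hi; first by rewrite big_nat1 /e /= v0 hi.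
    rewrite big_nat_recr//=; have [le|gt] := leP (cum_var i.+1 w) (rho k ^+ 2).
      by rewrite IH// /e /= -/(rho k) ltNge le addr0.
    rewrite {2}/e /= -/(rho k) gt hi big1_seq ?add0r// => l /andP[_].
    rewrite mem_index_iota => /andP[_ lk]; rewrite /e [X in _ && X](_ : _ = false) ?andbF//.
    apply/negbTE; rewrite -ltNge (le_lt_trans _ gt)// lerXn2r ?nnegrE ?(ltW (rho0 _))//.
    by rewrite ler_wpM2r ?(ltW a0)// ler_weXn2l ?ler1n.
  apply: (@le_trans _ _ (\sum_(0 <= l < L.+1) (thin_max (e l) w)%:E)%E).
    rewrite sumEFin lee_fin; apply: bigmax_le => [|j _].
      by apply: sumr_ge0 => l _; exact: bigmax_ge_id.
    have jN : (j <= N)%N by rewrite -ltnS.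
    rewrite split_sum//; apply: le_trans (ler_norm_sum _ _ _) _; apply: ler_sum => l _.
    exact: (le_bigmax _ (fun j : 'I_N.+1 => `|thin_sum (e l) j w|)).
  apply: (@le_trans _ _ (\sum_(0 <= l < L.+1) ((x * (D * rho l) * \1_(~` A l) w)%:E + W l w))%E).
    by apply: lee_sum => l _; have [_ _ h _] := HW l.
  rewrite big_split/=; apply: leeD; last exact: nneseries_lim_ge.
  rewrite sumEFin lee_fin.
  have := level_sum L.+1 a0 (cum_var_ge0 N w).
  rewrite -(ler_pM2l (_ : 0 < x * D)); last by rewrite mulr_gt0//; lra.
  rewrite mulr_sumr => h.
  rewrite (eq_big_nat _ _ (F2 := fun l => x * D * (2 ^+ l * a * ((level_lo a l < cum_var N w)%R)%:R))); last first.
    by move=> l _; rewrite G /rho; ring.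
  apply: le_trans h _; have xD0 : 0 < x * D by rewrite mulr_gt0//; lra.
  have xDa : 0 < x * D * a by rewrite mulr_gt0.
  by rewrite mulrDr; lra.
have mW l : measurable_fun [set: Omega] (W l) by have [] := HW l.
have W0 l w : (0 <= W l w)%E by have [] := HW l.
rewrite integral_nneseries//.
set E := expR _; have E0 : 0 < E by exact: expR_gt0.
have k0 : 0 <= 4 * D * E by rewrite !mulr_ge0 ?(ltW D0) ?(ltW E0).
have mG l : measurable_fun [set: Omega] (fun w => (4 * D * E * (2 ^+ l * a * ((level_lo a l < cum_var N w)%R)%:R))%:E).
  apply/measurable_EFinP; under eq_fun do rewrite -G; apply: measurable_funM => //.
  by apply: measurable_funM => //; apply: measurable_indic; exact: measurableC.
have G0 l w : (0 <= (4 * D * E * (2 ^+ l * a * ((level_lo a l < cum_var N w)%R)%:R))%:E)%E.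
  by rewrite lee_fin mulr_ge0// mulr_ge0// (ltW (rho0 l)).
have mS : measurable_fun [set: Omega] (fun w => Num.sqrt (cum_var N w)).
  apply: (measurableT_comp (f := @Num.sqrt R)); last exact: measurable_cum_varN.
  by apply: continuous_measurable_fun; exact: sqrt_continuous.
apply: (@le_trans _ _ (\sum_(l <oo) \int[P]_w (4 * D * E * (2 ^+ l * a * ((level_lo a l < cum_var N w)%R)%:R))%:E)%E).
  apply: lee_nneseries => [l _ _|l _]; first by apply: integral_ge0 => w _.
  have [_ _ _ h] := HW l; apply: le_trans h _.
  rewrite le_eqVlt; apply/orP; left; apply/eqP.
  rewrite -integral_cst//; last exact: measurableC.
  rewrite integral_mkcond; apply: eq_integral => w _.
  rewrite patchE -G indicE; case: ifP => _; rewrite ?mulr1 ?mulr0//.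
  by congr EFin; rewrite /= -/E /rho; ring.
rewrite -integral_nneseries//.
(* Applying [level_sum] under the integral leaves 4 D E (a + 4 sqrt Q_N); since E sqrt Q_N <= a,
   this yields the constant 4 + 16 = 20. *)
apply: (@le_trans _ _ (\int[P]_w ((4 * D * E * a)%:E + (16 * D * E)%:E * (Num.sqrt (cum_var N w))%:E))%E).
  apply: ge0_le_integral => //.
  - by move=> w _; apply: nneseries_ge0.
  - by apply: ge0_emeasurable_sum.
  - by apply/measurable_EFinP; apply: measurable_funD => //; exact: measurable_funM.
  - move=> w _; apply: nneseries_le => // K; rewrite sumEFin -EFinM -EFinD lee_fin -mulr_sumr.
    apply: le_trans (ler_wpM2l k0 (level_sum K a0 (cum_var_ge0 N w))) _.
    by rewrite le_eqVlt; apply/orP; left; apply/eqP; ring.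
rewrite ge0_integralD//=; first last.
- by apply/measurable_EFinP; exact: measurable_funM.
- by move=> w _; rewrite lee_fin !mulr_ge0 ?sqrtr_ge0 ?(ltW D0) ?(ltW E0).
- by move=> w _; rewrite lee_fin !mulr_ge0 ?(ltW a0) ?(ltW D0) ?(ltW E0).
rewrite probability_integral_cst ge0_integralZl//; first last.
- by rewrite lee_fin !mulr_ge0 ?(ltW D0) ?(ltW E0).
- exact/measurable_EFinP.
apply: le_trans (_ : ((4 * D * E * a)%:E + (16 * D * E)%:E * a%:E <= _)%E).
  by apply: leeD => //; rewrite lee_wpmul2l// lee_fin !mulr_ge0 ?(ltW D0) ?(ltW E0).
by rewrite -EFinM -EFinD lee_fin le_eqVlt; apply/orP; left; apply/eqP; ring.
Qed.

End process.

(** * Chaining *)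

Lemma diff_of_averages {R : realType} {V : lmodType R} (T : finType) (B1 B2 : {set T}) (u : T -> V) :
  (0 < #|B1|)%N -> (0 < #|B2|)%N ->
  (#|B1|%:R)^-1 *: \sum_(b in B1) u b - (#|B2|%:R)^-1 *: \sum_(c in B2) u c =
  (#|B1|%:R * #|B2|%:R)^-1 *: \sum_(b in B1) \sum_(c in B2) (u b - u c).
Proof.
move=> B10 B20.
have n1 : #|B1|%:R != 0 :> R by rewrite pnatr_eq0 -lt0n.
have n2 : #|B2|%:R != 0 :> R by rewrite pnatr_eq0 -lt0n.
have c (B : {set T}) (x : V) : \sum_(b in B) x = #|B|%:R *: x.
  by rewrite sumr_const scaler_nat.
have -> : \sum_(b in B1) \sum_(c in B2) (u b - u c) =
    #|B2|%:R *: (\sum_(b in B1) u b) - #|B1|%:R *: (\sum_(c in B2) u c).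
  rewrite -[X in _ = _ - X]c scaler_sumr -sumrB.
  by apply: eq_bigr => b _; rewrite sumrB c.
by rewrite scalerBr !scalerA; congr (_ *: _ - _ *: _); field; rewrite n1 n2.
Qed.

Lemma ge0_integral_sum_in {R : realType} d (Omega : measurableType d) (P : probability Omega R)
    (T : finType) (B : {set T}) (f : T -> Omega -> \bar R) :
  (forall b, measurable_fun [set: Omega] (f b)) -> (forall b w, 0 <= f b w)%E ->
  (\int[P]_w \sum_(b in B) f b w = \sum_(b in B) \int[P]_w f b w)%E.
Proof.
move=> mf f0; under eq_integral do rewrite -big_enum.
by rewrite ge0_integral_sum// big_enum.
Qed.

Lemma emeasurable_sum_in {R : realType} d (Omega : measurableType d)
    (T : finType) (B : {set T}) (f : T -> Omega -> \bar R) :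
  (forall b, measurable_fun [set: Omega] (f b)) ->
  measurable_fun [set: Omega] (fun w => \sum_(b in B) f b w)%E.
Proof.
by move=> mf; under eq_fun do rewrite -big_enum; exact: emeasurable_sum.
Qed.

Lemma sum2EFin {R : numDomainType} (I J : finType) (p : pred I) (q : pred J) (f : I -> J -> R) :
  (\sum_(i | p i) \sum_(j | q j) (f i j)%:E = (\sum_(i | p i) \sum_(j | q j) f i j)%:E)%E.
Proof. by rewrite -sumEFin; apply: eq_bigr => i _; rewrite sumEFin. Qed.

Lemma EFin_bigmax_le {R : realType} (I : Type) (r : seq I) (f : I -> R) (Z : \bar R) :
  (0 <= Z)%E -> (forall i, (f i)%:E <= Z)%E -> ((\big[Num.max/0]_(i <- r) f i)%:E <= Z)%E.
Proof.
move=> Z0 fZ; elim/big_ind : _ => // x y xZ yZ.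
by rewrite EFin_max ge_max xZ yZ.
Qed.

Section gauss_var_sub.
Context {R : realType} {X : normedModType R}.
Variables (s : nat -> X) (sX : forall x e, 0 < e -> exists n, `|x - s n| < e).

Lemma measurable_norm_linear m (L : {linear 'cV[R]_m -> X}) :
  measurable_fun [set: m.-tuple (measurableTypeR R)] (fun g => `|L (col_of_tuple g)|).
Proof.
apply: norm_measurable_norm; apply: (norm_measurable_linear sX (B := fun=> L)) => // v.
exact: norm_measurable_cst.
Qed.

(** From (y + z)^2 <= 2 y^2 + 2 z^2. It yields the triangle inequality for sigma up to a factor 2,
    which affects only the constants. *)
Lemma gauss_var_sub m (L L1 L2 : {linear 'cV[R]_m -> X}) :
  (forall v, L v = L1 v - L2 v) -> gauss_var L <= 2 * gauss_var L1 + 2 * gauss_var L2.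
Proof.
move=> LE; rewrite -lee_fin EFinD !EFinM -!(gauss_varE sX).
have m2 (K : {linear 'cV[R]_m -> X}) :
    measurable_fun [set: m.-tuple (measurableTypeR R)] (fun g => (`|K (col_of_tuple g)| ^+ 2)%:E).
  by apply/measurable_EFinP; apply: measurable_funX; exact: measurable_norm_linear.
have p2 (K : {linear 'cV[R]_m -> X}) g : (0 <= (`|K (col_of_tuple g)| ^+ 2)%:E)%E.
  by rewrite lee_fin sqr_ge0.
have m2' (K : {linear 'cV[R]_m -> X}) :
    measurable_fun [set: m.-tuple (measurableTypeR R)] (fun g => 2%:E * (`|K (col_of_tuple g)| ^+ 2)%:E)%E.
  by apply: emeasurable_funM => //; exact: m2.
have Z (K : {linear 'cV[R]_m -> X}) : (2%:E * \int[std_gauss R m]_g (`|K (col_of_tuple g)| ^+ 2)%:E =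
    \int[std_gauss R m]_g (2%:E * (`|K (col_of_tuple g)| ^+ 2)%:E))%E.
  by rewrite ge0_integralZl//; exact: m2.
rewrite !Z.
rewrite -ge0_integralD//.
apply: ge0_le_integral => //; first by apply: emeasurable_funD; exact: m2'.
move=> g _; rewrite -!EFinM -EFinD lee_fin LE.
have := ler_normB (L1 (col_of_tuple g)) (L2 (col_of_tuple g)).
have := normr_ge0 (L1 (col_of_tuple g) - L2 (col_of_tuple g)).
set x := `|_ - _|; set y := `|L1 _|; set z := `|L2 _| => x0 xyz.
apply: (@le_trans _ _ ((y + z) ^+ 2)); first by rewrite lerXn2r// nnegrE (le_trans x0).
have := sqr_ge0 (y - z); rewrite sqrrB sqrrD; lra.
Qed.

End gauss_var_sub.

Section chaining.
Context {R : realType} {T : finZmodType} {X : normedModType R}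
  {d : measure_display} {Omega : measurableType d}.
Variables (s : nat -> X) (sX : forall x e, 0 < e -> exists n, `|x - s n| < e).
Variables (P : probability Omega R) (N : nat) (F : nat -> set (set Omega)) (m : nat -> nat).
Variable gamma : forall i, Omega -> (m i).-tuple (measurableTypeR R).
Variable A : forall i, T -> Omega -> {linear 'cV[R]_(m i) -> X}.
Variables (sigma : T -> Omega -> R) (D : R).
Hypotheses (D1 : 1 <= D) (sm : smooth2 X D).
Hypothesis Hpg : predictable_gaussian P N F gamma A.
Hypothesis msigma : forall h, measurable_fun [set: Omega] (sigma h).
Hypothesis sigma0 : forall h w, 0 <= sigma h w.
Hypothesis Hd :
  {ae P, forall w, forall t u, sq_dist N A w t u = (sigma (t - u) w)%:E}.

Let D0 : 0 < D. Proof. by rewrite (lt_le_trans ltr01). Qed.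

Definition diff_op x y i w : {linear 'cV[R]_(m i) -> X} := A i x w \- A i y w.

Lemma sq_distE x y w : sq_dist N A w x y = (Num.sqrt (cum_var (diff_op x y) N w))%:E.
Proof.
rewrite /sq_dist (eq_bigr (fun i : 'I_N => (step_var (diff_op x y) i w)%:E)); last first.
  by move=> i _; exact: (gamma_norm_sqr sX (diff_op x y i w)).
by rewrite sumEFin.
Qed.

Lemma predictable_norm_measurable i x v : (i < N)%N ->
  norm_measurable (fun w : g_sigma_algebraType (F i) => A i x w v).
Proof.
move=> iN z; apply: measurable_fun_ltr_preimage => c.
have [c0|c0] := leP c 0.
  rewrite (_ : [set _ | _] = set0)//; apply/seteqP; split=> w //=.
  by rewrite ltNge (le_trans c0).
apply: sub_sigma_algebra; have := @pg_predictable _ _ _ _ _ _ _ _ _ _ _ Hpg i iN x v; apply.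
exists (ball z c); first by apply: sub_sigma_algebra; exact: ball_open.
by rewrite setTI; apply/seteqP; split=> w /=; rewrite -ball_normE/= distrC.
Qed.

Lemma diff_op_norm_measurable x y i : (i < N)%N -> forall v,
  norm_measurable (fun w : g_sigma_algebraType (F i) => diff_op x y i w v).
Proof.
move=> iN v; apply: (norm_measurableD sX); first exact: predictable_norm_measurable.
rewrite (_ : (fun _ => _) = fun w : g_sigma_algebraType (F i) => -1 *: A i y w v); last first.
  by apply/funext => w; rewrite scaleN1r.
by apply: (norm_measurableZ sX) => //; exact: predictable_norm_measurable.
Qed.

Lemma adapted_measurable i : (i < N)%N ->
  measurable_fun [set: g_sigma_algebraType (F i.+1)]
    (gamma i : g_sigma_algebraType (F i.+1) -> _).
Proof.
move=> iN _ Y mY; apply: sub_sigma_algebra; have := pg_adapted Hpg iN; apply.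
by exists Y.
Qed.

Let Ffil : filtration N F := pg_filtration Hpg.

Lemma pred_sum_diff x y j w :
  pred_sum gamma (diff_op x y) j w = gauss_sum gamma A j x w - gauss_sum gamma A j y w.
Proof. by rewrite /pred_sum /gauss_sum -sumrB. Qed.

Lemma measurable_pred_sum x y j : (j <= N)%N ->
  measurable_fun [set: Omega] (fun w => `|gauss_sum gamma A j x w - gauss_sum gamma A j y w|).
Proof.
move=> jN.
have := @measurable_thin_sum R X d Omega s sX N F m gamma (diff_op x y) Ffil adapted_measurable
  (diff_op_norm_measurable x y) (fun _ _ => 1) (fun _ _ => measurable_cst _) j jN.
congr measurable_fun; apply/funext => w; congr (`|_|).
by rewrite -pred_sum_diff; apply: eq_bigr => i _; rewrite scale1r.
Qed.

Definition pair_max x y w : R := \big[Num.max/0]_(j < N.+1)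
  `|gauss_sum gamma A j x w - gauss_sum gamma A j y w|.

Lemma measurable_max_osc : measurable_fun [set: Omega] (max_osc N gamma A).
Proof.
apply: measurable_bigmaxr => j; apply: measurable_bigmaxr => t.
by apply: measurable_bigmaxr => u; apply: measurable_pred_sum; rewrite -ltnS.
Qed.

Lemma sigmaE : {ae P, forall w, forall x y,
  Num.sqrt (cum_var (diff_op x y) N w) = sigma (x - y) w}.
Proof. by apply: filterS Hd => w h x y; have := h x y; rewrite sq_distE => -[]. Qed.

Lemma pair_excess x y a lam : 0 < a -> 4 <= lam -> ('E_P[sigma (x - y)%R] <= a%:E)%E ->
  exists W : Omega -> \bar R, [/\ measurable_fun [set: Omega] W, (forall w, 0 <= W w)%E,
    {ae P, forall w,
      ((pair_max x y w)%:E <= (4 * lam * D * (sigma (x - y) w + a))%:E + W w)%E} &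
    (\int[P]_w W w <= (20 * D * a * expR (- (lam ^+ 2 / 8)))%:E)%E].
Proof.
move=> a0 lam4 Ea.
have mS : measurable_fun [set: Omega] (fun w => Num.sqrt (cum_var (diff_op x y) N w)).
  apply: (measurableT_comp (f := @Num.sqrt R)).
    by apply: continuous_measurable_fun; exact: sqrt_continuous.
  exact: (measurable_cum_varN sX Ffil (diff_op_norm_measurable x y)).
have ES : (\int[P]_w (Num.sqrt (cum_var (diff_op x y) N w))%:E <= a%:E)%E.
  rewrite unlock in Ea; apply: le_trans Ea; rewrite le_eqVlt; apply/orP; left; apply/eqP.
  apply: ge0_ae_eq_integral => //.
  - exact/measurable_EFinP.
  - exact/measurable_EFinP.
  - by move=> w _; rewrite lee_fin.
  by apply: filterS sigmaE => w h _; rewrite h.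
have [W [mW W0 HW iW]] := pred_max_excess sX Ffil (pg_gauss Hpg) (pg_indep Hpg)
  adapted_measurable (diff_op_norm_measurable x y) D1 sm a0 lam4 ES.
exists W; split => //; apply: filterS sigmaE => w h.
rewrite -h; apply: le_trans (HW w); rewrite lee_fin le_eqVlt; apply/orP; left; apply/eqP.
by apply: eq_bigr => j _; rewrite pred_sum_diff.
Qed.

(** By translation invariance sigma(h) and sigma(k) are the distances of h and k to 0, and sigma(h -
    k) is the distance between h and k. *)
Lemma sigma_quasi_triangle :
  {ae P, forall w, forall h k, sigma (h - k) w <= 2 * (sigma h w + sigma k w)}.
Proof.
apply: filterS sigmaE => w E h k.
rewrite -(E h k) -[h in leRHS]subr0 -(E h 0) -[k in sigma k]subr0 -(E k 0).
set u := Num.sqrt (cum_var (diff_op h 0) N w); set v := Num.sqrt (cum_var (diff_op k 0) N w).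
have u0 : 0 <= u by exact: sqrtr_ge0.
have v0 : 0 <= v by exact: sqrtr_ge0.
rewrite -[leRHS]ger0_norm ?mulr_ge0 ?addr_ge0// -sqrtr_sqr ler_wsqrtr//.
apply: (@le_trans _ _ (2 * u ^+ 2 + 2 * v ^+ 2)); last by nra.
rewrite !sqr_sqrtr ?cum_var_ge0// /cum_var !mulr_sumr -big_split/=.
apply: ler_sum => i _; apply: (gauss_var_sub sX) => z /=.
by rewrite /diff_op/= opprB addrA subrK.
Qed.

Lemma sigma_zero : {ae P, forall w, sigma 0 w = 0}.
Proof.
apply: filterS sigmaE => w E; rewrite -(subrr 0) -E (_ : cum_var _ _ _ = 0) ?sqrtr0//.
rewrite /cum_var big1// => i _; rewrite /step_var /gauss_var.
rewrite (_ : (fun g => _) = cst 0%E) ?integral0//.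
by apply/funext => g; rewrite /diff_op /= subrr normr0 expr0n.
Qed.

Variable alpha : T -> R.
Hypothesis Ealpha : forall h, ('E_P[sigma h] = (alpha h)%:E)%E.

Lemma alpha0 : alpha 0 = 0.
Proof.
apply/eqP; rewrite -eqe -Ealpha unlock; apply/eqP.
rewrite -[RHS](integral0 P [set: Omega]); apply: ge0_ae_eq_integral => //.
- exact/measurable_EFinP.
- by move=> w _; rewrite lee_fin.
- by apply: filterS sigma_zero => w ->.
Qed.

Lemma alpha_quasi_triangle h k : alpha (h - k) <= 2 * (alpha h + alpha k).
Proof.
rewrite -lee_fin (EFinM 2) (EFinD (alpha h)) -!Ealpha unlock.
rewrite -ge0_integralD//; first last.
- exact/measurable_EFinP.
- by move=> w _; rewrite lee_fin.
- exact/measurable_EFinP.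
- by move=> w _; rewrite lee_fin.
rewrite -ge0_integralZl//; first last.
- by move=> w _; rewrite -EFinD lee_fin addr_ge0.
- by apply/measurable_EFinP; exact: measurable_funD.
apply: ae_ge0_le_integral => //.
- by move=> w _; rewrite lee_fin.
- exact/measurable_EFinP.
- by move=> w _; rewrite -EFinD -EFinM lee_fin mulr_ge0// addr_ge0.
- by apply/measurable_EFinP; apply: measurable_funM => //; exact: measurable_funD.
- by apply: filterS sigma_quasi_triangle => w E _; rewrite -EFinD -EFinM lee_fin.
Qed.

(** The integrand of [entropy_int], as a function of the ball. *)
Definition ent (B : {pred T}) : R := Num.sqrt (ln (expR 1 / unif_meas R B)).

Lemma eq_ent (B B' : {pred T}) : B =i B' -> ent B = ent B'.
Proof. by move=> BB; rewrite /ent /unif_meas (eq_card BB). Qed.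

Lemma cardT_gt0 : 0 < #|T|%:R :> R.
Proof. by rewrite ltr0n; apply/card_gt0P; exists 0. Qed.

Lemma ent_arg_ge (B : {pred T}) : (0 < #|B|)%N -> expR 1 <= expR 1 / unif_meas R B.
Proof.
move=> B0; have c0 : 0 < #|B|%:R :> R by rewrite ltr0n.
rewrite /unif_meas ler_pdivlMr ?divr_gt0 ?cardT_gt0// ler_piMr ?expR_ge0//.
by rewrite ler_pdivrMr ?cardT_gt0// mul1r ler_nat max_card.
Qed.

Lemma ent_sqr (B : {pred T}) : (0 < #|B|)%N -> ent B ^+ 2 = ln (expR 1 / unif_meas R B).
Proof.
move=> B0; rewrite sqr_sqrtr// ln_ge0// (le_trans _ (ent_arg_ge B0))//.
by rewrite -[leLHS]expR0 ler_expR.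
Qed.

Lemma ent_ge1 (B : {pred T}) : (0 < #|B|)%N -> 1 <= ent B.
Proof.
move=> B0; rewrite -[leLHS]sqrtr1 ler_wsqrtr// -[leLHS](expRK 1).
by rewrite ler_ln ?posrE ?expR_gt0 ?ent_arg_ge// (lt_le_trans (expR_gt0 1))// ent_arg_ge.
Qed.

Definition avg (B : {set T}) j t w : X :=
  (#|B|%:R)^-1 *: \sum_(b in B) gauss_sum gamma A j (t + b) w.

Lemma avg_sub (B1 B2 : {set T}) j t w : (0 < #|B1|)%N -> (0 < #|B2|)%N ->
  avg B1 j t w - avg B2 j t w = (#|B1|%:R * #|B2|%:R)^-1 *:
    \sum_(b in B1) \sum_(c in B2) (gauss_sum gamma A j (t + b) w - gauss_sum gamma A j (t + c) w).
Proof.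
by move=> B10 B20; rewrite /avg; exact: diff_of_averages.
Qed.

Lemma sum_translate_le (B : {set T}) (t : T) (g : T -> \bar R) :
  (forall x, 0 <= g x)%E -> (\sum_(b in B) g (t + b)%R <= \sum_x g x)%E.
Proof.
move=> g0; rewrite [leRHS](reindex_inj (addrI t))/= big_mkcond/=.
by apply: lee_sum => b _; case: ifP.
Qed.

(* With lam = 4 ent B2, exp(-lam^2 / 8) = (#|B2| / (e #|T|))^2, which absorbs the sum
   of the errors over all #|T|^2 pairs divided by the weight #|B1| * #|B2|. *)
Lemma chain_step (B1 B2 : {set T}) (rho : R) : 0 < rho ->
  (forall h, h \in B1 -> alpha h <= rho) -> B2 \subset B1 -> (0 < #|B2|)%N ->
  exists V : Omega -> \bar R, [/\ measurable_fun [set: Omega] V, (forall w, 0 <= V w)%E,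
    {ae P, forall w, forall j t, (j <= N)%N -> ((`|avg B1 j t w - avg B2 j t w|)%:E <= V w)%E} &
    (\int[P]_w V w <= (208 * D * (rho * ent [in B2]))%:E)%E].
Proof.
move=> rho0 arho B21 B20.
have B10 : (0 < #|B1|)%N by rewrite (leq_trans B20)// subset_leq_card.
set phi := ent [in B2]; have phi1 : 1 <= phi by exact: ent_ge1.
pose lam := 4 * phi; have lam4 : 4 <= lam by rewrite /lam; lra.
(* For b in B1 and b' in B2 the quasi-triangle inequality gives alpha(b - b') <= 2 (rho + rho). *)
have r40 : 0 < 4 * rho by rewrite mulr_gt0.
pose E := 20 * D * (4 * rho) * expR (- (lam ^+ 2 / 8)).
have E0 : 0 <= E by rewrite !mulr_ge0 ?expR_ge0 ?(ltW D0) ?(ltW rho0).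
(* Errors are chosen for all pairs; a pair with alpha above 4 rho never occurs as a link, and W = 0
   serves for it. *)
have /choice[W HW] : forall z : T * T, exists W : Omega -> \bar R,
   [/\ measurable_fun [set: Omega] W, (forall w, 0 <= W w)%E,
    alpha (z.1 - z.2) <= 4 * rho -> {ae P, forall w,
      ((pair_max z.1 z.2 w)%:E <= (4 * lam * D * (sigma (z.1 - z.2) w + 4 * rho))%:E + W w)%E} &
    (\int[P]_w W w <= E%:E)%E].
  move=> [x y] /=; have [h|h] := leP (alpha (x - y)) (4 * rho); last first.
    exists (cst 0%E); split => //; last by rewrite integral0 lee_fin.
  have [|W [? ? ? ?]] := @pair_excess x y _ _ r40 lam4; first by rewrite Ealpha lee_fin.
  by exists W; split.
have mW z : measurable_fun [set: Omega] (W z) by have [] := HW z.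
have W0 z w : (0 <= W z w)%E by have [] := HW z.
pose c : R := (#|B1|%:R * #|B2|%:R)^-1.
have c0 : 0 < c by rewrite invr_gt0 mulr_gt0 ?ltr0n.
pose k := 4 * lam * D; have k0 : 0 < k by rewrite !mulr_gt0//; lra.
pose S w := (\sum_(b in B1) \sum_(b' in B2) (sigma (b - b')%R w)%:E)%E.
(* The first term averages sigma(b - b'), which is free of t. In the second, the sum over translated
   pairs is enlarged to all pairs, which removes t as well. *)
pose V w := (k%:E * (c%:E * S w + (4 * rho)%:E) + c%:E * \sum_x \sum_y W (x, y) w)%E.
have S0 w : (0 <= S w)%E by apply: sume_ge0 => b _; apply: sume_ge0 => b' _; rewrite lee_fin.
have mS : measurable_fun [set: Omega] S.
  by apply: emeasurable_sum_in => b; apply: emeasurable_sum_in => b'; exact/measurable_EFinP.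
have SW0 w : (0 <= \sum_x \sum_y W (x, y) w)%E.
  by apply: sume_ge0 => x _; apply: sume_ge0 => y _.
have mSW : measurable_fun [set: Omega] (fun w => \sum_x \sum_y W (x, y) w)%E.
  by apply: emeasurable_sum => x; apply: emeasurable_sum => y.
have V10 w : (0 <= k%:E * (c%:E * S w + (4 * rho)%:E))%E.
  by rewrite mule_ge0 ?lee_fin ?(ltW k0)// adde_ge0 ?lee_fin ?(ltW r40)// mule_ge0 ?lee_fin ?(ltW c0).
have mcS : measurable_fun [set: Omega] (fun w => c%:E * S w)%E by exact: emeasurable_funM.
have mV1 : measurable_fun [set: Omega] (fun w => k%:E * (c%:E * S w + (4 * rho)%:E))%E.
  by apply: emeasurable_funM => //; exact: emeasurable_funD.
have mV2 : measurable_fun [set: Omega] (fun w => c%:E * \sum_x \sum_y W (x, y) w)%E.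
  exact: emeasurable_funM.
have good b b' t : b \in B1 -> b' \in B2 -> alpha ((t + b) - (t + b')) <= 4 * rho.
  move=> bB1 bB2; rewrite opprD addrACA subrr add0r.
  apply: le_trans (alpha_quasi_triangle _ _) _.
  have := arho _ bB1; have := arho _ (fintype.subsetP B21 _ bB2); lra.
exists V; split.
- exact: emeasurable_funD.
- by move=> w; rewrite adde_ge0// mule_ge0 ?lee_fin ?(ltW c0).
- have ae z : {ae P, forall w, alpha (z.1 - z.2) <= 4 * rho ->
      ((pair_max z.1 z.2 w)%:E <= (k * (sigma (z.1 - z.2) w + 4 * rho))%:E + W z w)%E}.
    have [h|h] := leP (alpha (z.1 - z.2)) (4 * rho).
      by have [_ _ /(_ h) H _] := HW z; apply: filterS H => w ? _.
    by apply: nearW => w.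
  have aeT : {ae P, forall w, forall z, alpha (z.1 - z.2) <= 4 * rho ->
      ((pair_max z.1 z.2 w)%:E <= (k * (sigma (z.1 - z.2) w + 4 * rho))%:E + W z w)%E}.
    exact: filter_forall.
  apply: filterS aeT => w Hw j t jN.
  rewrite avg_sub// normrZ (gtr0_norm c0) EFinM.
  apply: (@le_trans _ _ (c%:E * \sum_(b in B1) \sum_(b' in B2)
     ((k * (sigma (b - b') w + 4 * rho))%:E + W ((t + b)%R, (t + b')%R) w))%E).
    rewrite lee_wpmul2l ?lee_fin ?(ltW c0)//.
    apply: (@le_trans _ _ (\sum_(b in B1) \sum_(b' in B2)
        (`|gauss_sum gamma A j (t + b)%R w - gauss_sum gamma A j (t + b')%R w|)%:E)%E).
      rewrite sum2EFin lee_fin; apply: le_trans (ler_norm_sum _ _ _) _.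
      by apply: ler_sum => b _; exact: ler_norm_sum.
    apply: lee_sum => b bB1; apply: lee_sum => b' bB2.
    have := Hw ((t + b), (t + b'))%R (good b b' t bB1 bB2).
    rewrite /= [X in sigma X](_ : _ = b - b'); last by rewrite opprD addrACA subrr add0r.
    apply: le_trans; rewrite lee_fin.
    have jN1 : (j < N.+1)%N by [].
    exact: (le_bigmax _ (fun j : 'I_N.+1 => `|gauss_sum gamma A j (t + b)%R w - gauss_sum gamma A j (t + b')%R w|) (Ordinal jN1)).
  under eq_bigr do rewrite big_split/=.
  rewrite big_split/= ge0_muleDr; first last.
  - by apply: sume_ge0 => b _; apply: sume_ge0 => b' _.
  - apply: sume_ge0 => b _; apply: sume_ge0 => b' _.
    by rewrite lee_fin mulr_ge0 ?(ltW k0)// addr_ge0// ltW.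
  apply: leeD.
    rewrite le_eqVlt; apply/orP; left; apply/eqP.
    have eqR : c * \sum_(b in B1) \sum_(b' in B2) k * (sigma (b - b') w + 4 * rho) =
        k * (c * \sum_(b in B1) \sum_(b' in B2) sigma (b - b') w + 4 * rho).
      under eq_bigr do rewrite -mulr_sumr big_split/= sumr_const.
      rewrite -mulr_sumr big_split/= sumr_const.
      rewrite mulrCA; congr (_ * _); rewrite mulrDr; congr (_ + _).
      rewrite -[_ *+ _ *+ _]mulr_natr -[_ *+ _]mulr_natr /c; field.
      by rewrite !pnatr_eq0 -!lt0n B10 B20.
    by rewrite sum2EFin -EFinM eqR /S sum2EFin.
  rewrite lee_wpmul2l ?lee_fin ?(ltW c0)//.
  apply: le_trans (sum_translate_le B1 t (g := fun x => \sum_y W (x, y) w)%E _); last first.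
    by move=> x; apply: sume_ge0 => y _.
  by apply: lee_sum => b _; exact: (sum_translate_le B2 t (g := fun y => W ((t + b)%R, y) w)).
rewrite ge0_integralD//; last by move=> w _; rewrite mule_ge0 ?lee_fin ?(ltW c0).
rewrite ge0_integralZl//; first last.
- by rewrite lee_fin ltW.
- by move=> w _; rewrite adde_ge0 ?lee_fin ?(ltW r40)// mule_ge0 ?lee_fin ?(ltW c0).
- exact: emeasurable_funD.
rewrite ge0_integralZl//; last by rewrite lee_fin ltW.
rewrite ge0_integralD//; first last.
- by move=> w _; rewrite lee_fin ltW.
- by move=> w _; rewrite mule_ge0 ?lee_fin ?(ltW c0).
rewrite probability_integral_cst ge0_integralZl//; last by rewrite lee_fin ltW.
have iS : (\int[P]_w S w <= (c^-1 * (4 * rho))%:E)%E.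
  rewrite /S ge0_integral_sum_in; first last.
  - by move=> b w; apply: sume_ge0 => b' _; rewrite lee_fin.
  - by move=> b; apply: emeasurable_sum_in => b'; exact/measurable_EFinP.
  apply: (@le_trans _ _ (\sum_(b in B1) \sum_(b' in B2) (4 * rho)%:E)%E).
    apply: lee_sum => b bB1; rewrite ge0_integral_sum_in; first last.
    - by move=> b' w; rewrite lee_fin.
    - by move=> b'; exact/measurable_EFinP.
    apply: lee_sum => b' bB2; have := Ealpha (b - b'); rewrite unlock => ->.
    by have := good b b' 0 bB1 bB2; rewrite !add0r lee_fin.
  rewrite sum2EFin lee_fin !sumr_const -[_ *+ _ *+ _]mulr_natr -[_ *+ _]mulr_natr.
  by rewrite /c invrK le_eqVlt; apply/orP; left; apply/eqP; ring.
have iW : (\int[P]_w (\sum_x \sum_y W (x, y) w) <= (#|T|%:R ^+ 2 * E)%:E)%E.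
  rewrite ge0_integral_sum//; last first.
  - by move=> x w _; apply: sume_ge0.
  - by move=> x; apply: emeasurable_sum.
  apply: (@le_trans _ _ (\sum_(x : T) \sum_(y : T) E%:E)%E).
    apply: lee_sum => x _; rewrite ge0_integral_sum//.
    by apply: lee_sum => y _; have [] := HW (x, y).
  by rewrite sum2EFin lee_fin !sumr_const -[_ *+ _ *+ _]mulr_natr -[_ *+ _]mulr_natr -mulrA -expr2 mulrC.
apply: le_trans (_ : (k%:E * (c%:E * (c^-1 * (4 * rho))%:E + (4 * rho)%:E) +
   c%:E * (#|T|%:R ^+ 2 * E)%:E <= _)%E).
  apply: leeD; last by rewrite lee_wpmul2l ?lee_fin ?(ltW c0).
  rewrite lee_wpmul2l ?lee_fin ?(ltW k0)//; apply: leeD => //.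
  by rewrite lee_wpmul2l ?lee_fin ?(ltW c0).
rewrite -[leLHS]/((k * (c * (c^-1 * (4 * rho)) + 4 * rho) + c * (#|T|%:R ^+ 2 * E))%:E).
rewrite lee_fin mulVKf ?gt_eqF//.
have key : c * #|T|%:R ^+ 2 * expR (- (lam ^+ 2 / 8)) <= 1.
  have -> : lam ^+ 2 / 8 = 2 * ln (expR 1 / unif_meas R [in B2]).
    by rewrite -ent_sqr// -/phi /lam; field.
  have u0 : 0 < expR 1 / unif_meas R [in B2].
    exact: lt_le_trans (expR_gt0 1) (ent_arg_ge B20).
  rewrite expRN expRM_natl lnK ?posrE//.
  have b2 : 0 < #|B2|%:R :> R by rewrite ltr0n.
  have b1 : 0 < #|B1|%:R :> R by rewrite ltr0n.
  have t0 := cardT_gt0.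
  have -> : c * #|T|%:R ^+ 2 * ((expR 1 / unif_meas R [in B2]) ^+ 2)^-1 =
      #|B2|%:R / #|B1|%:R / (expR 1) ^+ 2.
    by rewrite /c /unif_meas; field; rewrite !gt_eqF// expR_gt0.
  rewrite mulr_ile1 ?invr_ge0 ?sqr_ge0//.
  + by rewrite ler_pdivrMr// mul1r ler_nat subset_leq_card.
  + rewrite invf_le1 ?exprn_gt0 ?expR_gt0// exprn_ege1//.
    by rewrite -[leLHS]expR0 ler_expR.
have -> : c * (#|T|%:R ^+ 2 * E) = c * #|T|%:R ^+ 2 * expR (- (lam ^+ 2 / 8)) * (80 * D * rho).
  by rewrite /E; ring.
have Dr : 0 <= 80 * D * rho by rewrite !mulr_ge0 ?(ltW D0) ?(ltW rho0).
(* Here k = 16 D phi, so the main term is 128 D rho phi; as phi >= 1 the error adds at most 80 D rho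
   phi, for a total of 208. *)
apply: (@le_trans _ _ (k * (4 * rho + 4 * rho) + 80 * D * rho)).
  by rewrite lerD2l ler_piMl.
have : D * rho * 1 <= D * rho * phi by rewrite ler_wpM2l// mulr_ge0// ltW.
by rewrite /k /lam -/phi; lra.
Qed.

(** After the ball of index K the chain jumps to {0}, so that the last average is f_j(t) itself; a
    small ball would not do, as alpha may vanish off 0. *)
Definition chain_set (Delta : R) (K k : nat) : {set T} :=
  if (k <= K)%N then [set h | (alpha h <= 2^-1 ^+ k * Delta)%R]%SET else [set 0%R]%SET.

(** The points t and u are both joined to the average over the whole group, hence 416 = 2 * 208. The
    last summand is the price of the final jump to {0} and becomes small for large K. *)
Lemma gauss_chain (Delta : R) K : 0 < Delta -> (forall h, alpha h <= Delta) ->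
  ('E_P[max_osc N gamma A] <= (416 * D * (\sum_(0 <= k < K)
      2^-1 ^+ k * Delta * ent [pred h | alpha h <= 2^-1 ^+ k.+1 * Delta] +
    2^-1 ^+ K * Delta * ent (pred1 (0 : T))))%:E)%E.
Proof.
move=> De0 aDe.
pose B := chain_set Delta K; pose rho k := 2^-1 ^+ k * Delta.
have rho0 k : 0 < rho k by rewrite mulr_gt0// exprn_gt0.
have B0k k : 0 \in B k.
  by rewrite /B /chain_set; case: ifP => _; rewrite inE ?eqxx// alpha0 ltW// rho0.
have Bsub k : B k.+1 \subset B k.
  apply/fintype.subsetP => h; rewrite /B /chain_set; have [kK|kK] := leqP k.+1 K.
    rewrite (ltnW kK) !inE => /le_trans; apply.
    by rewrite ler_wpM2r ?(ltW De0)// exprS ler_piMl ?exprn_ge0//; lra.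
  by rewrite inE => /eqP ->; exact: (B0k k).
have Brho k h : h \in B k -> alpha h <= rho k.
  rewrite /B /chain_set; case: ifP => _; rewrite inE// => /eqP ->.
  by rewrite alpha0 ltW.
have /choice[V HV] : forall k, exists V : Omega -> \bar R,
    [/\ measurable_fun [set: Omega] V, (forall w, 0 <= V w)%E,
    {ae P, forall w, forall j t, (j <= N)%N ->
      ((`|avg (B k) j t w - avg (B k.+1) j t w|)%:E <= V w)%E} &
    (\int[P]_w V w <= (208 * D * (rho k * ent [in B k.+1]))%:E)%E].
  move=> k; apply: chain_step => //; first exact: Brho.
  by apply/card_gt0P; exists 0.
have mV k : measurable_fun [set: Omega] (V k) by have [] := HV k.
have V0 k w : (0 <= V k w)%E by have [] := HV k.
pose S w := (\sum_(0 <= k < K.+1) V k w)%E.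
have S0 w : (0 <= S w)%E by apply: sume_ge0.
have mS : measurable_fun [set: Omega] S by exact: emeasurable_sum.
have path : {ae P, forall w, ((max_osc N gamma A w)%:E <= S w + S w)%E}.
  have aeT : {ae P, forall w, forall k : 'I_K.+1, forall j t, (j <= N)%N ->
      ((`|avg (B k) j t w - avg (B k.+1) j t w|)%:E <= V k w)%E}.
    by apply: filter_forall => k; have [] := HV k.
  apply: filterS aeT => w Hw.
  have BT : B 0 = [set: T]%SET.
    by apply/setP => h; rewrite /B /chain_set leq0n !inE expr0 mul1r aDe.
  have BK : B K.+1 = [set 0%R]%SET by rewrite /B /chain_set ltnn.
  (* A translate of the whole group is the group itself, so all chains start from a common value. *)
  have avgT j t : avg [set: T]%SET j t w = avg [set: T]%SET j 0 w.
    rewrite /avg; congr (_ *: _); under eq_bigl do rewrite inE.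
    under [in RHS]eq_bigl do rewrite inE.
    rewrite -(reindex_inj (addrI t) (P := predT) (F := fun x => gauss_sum gamma A j x w))/=.
    by apply: eq_bigr => x _; rewrite add0r.
  have avg0 j t : avg [set 0%R]%SET j t w = gauss_sum gamma A j t w.
    by rewrite /avg big_set1 cards1 invr1 scale1r addr0.
  have dist j t : (j <= N)%N -> ((`|avg [set: T]%SET j 0 w - gauss_sum gamma A j t w|)%:E <= S w)%E.
    move=> jN; rewrite -avg0 -(avgT j t) -BT -BK.
    have -> : avg (B 0) j t w - avg (B K.+1) j t w =
        \sum_(0 <= k < K.+1) (avg (B k) j t w - avg (B k.+1) j t w).
      have := @telescope_sumr _ 0 K.+1 (fun k => - avg (B k) j t w) (leq0n _).
      rewrite opprK addrC => <-; apply: eq_bigr => k _.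
      by rewrite opprK addrC.
    apply: (@le_trans _ _ (\sum_(0 <= k < K.+1) (`|avg (B k) j t w - avg (B k.+1) j t w|)%:E)%E).
      by rewrite sumEFin lee_fin; exact: ler_norm_sum.
    rewrite /S !big_mkord; apply: lee_sum => k _; exact: Hw.
  have SS0 : (0 <= S w + S w)%E by rewrite adde_ge0.
  apply: EFin_bigmax_le => // j; apply: EFin_bigmax_le => // t; apply: EFin_bigmax_le => // u.
  have jN : (j <= N)%N by rewrite -ltnS.
  apply: (@le_trans _ _ ((`|avg [set: T]%SET j 0 w - gauss_sum gamma A j t w|)%:E +
     (`|avg [set: T]%SET j 0 w - gauss_sum gamma A j u w|)%:E)%E); last first.
    by apply: leeD; exact: dist.
  rewrite -EFinD lee_fin -[`|_ - gauss_sum gamma A j t w|]normrN opprB.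
  exact: ler_distD.
rewrite unlock.
apply: (@le_trans _ _ (\int[P]_w (S w + S w))%E).
  apply: ae_ge0_le_integral => //.
  - by move=> w _; rewrite lee_fin; exact: bigmax_ge_id.
  - by apply/measurable_EFinP; exact: measurable_max_osc.
  - by move=> w _; rewrite adde_ge0.
  - exact: emeasurable_funD.
  - by apply: filterS path.
rewrite ge0_integralD// /S ge0_integral_sum//.
apply: (@le_trans _ _ (\sum_(0 <= k < K.+1) (208 * D * (rho k * ent [in B k.+1]))%:E +
  \sum_(0 <= k < K.+1) (208 * D * (rho k * ent [in B k.+1]))%:E)%E).
  by apply: leeD; apply: lee_sum => k _; have [] := HV k.
rewrite sumEFin -EFinD lee_fin -mulr_sumr big_nat_recr//=.
rewrite (eq_big_nat _ _ (F2 := fun k => 2^-1 ^+ k * Delta *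
    ent [pred h | alpha h <= 2^-1 ^+ k.+1 * Delta])); last first.
  move=> k /andP[_ kK]; rewrite /rho; congr (_ * _); apply: eq_ent => h.
  by rewrite /B /chain_set kK !inE.
have -> : ent [in B K.+1] = ent (pred1 0).
  by apply: eq_ent => h; rewrite /B /chain_set ltnn !inE.
by rewrite /rho le_eqVlt; apply/orP; left; apply/eqP; ring.
Qed.

End chaining.

(** * The entropy integral *)

Section entropy.
Context {R : realType} {T : finZmodType}.
Variable alpha : T -> R.
Hypothesis alpha0 : alpha 0 = 0.
Local Notation mu := (@lebesgue_measure R).

Let ball_ent (r : R) : R := ent [pred h | alpha h <= r].

Let card_ball (r : R) : 0 <= r -> (0 < #|[pred h | (alpha h <= r)%R]|)%N.
Proof. by move=> r0; apply/card_gt0P; exists 0; rewrite inE alpha0. Qed.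

Let ball_ent_anti (r t : R) : 0 <= r -> r <= t -> ball_ent t <= ball_ent r.
Proof.
move=> r0 rt; have cr := card_ball r0; have ct := card_ball (le_trans r0 rt).
have h : 0 < expR 1 / unif_meas R [pred h | alpha h <= t].
  exact: lt_le_trans (expR_gt0 1) (ent_arg_ge ct).
rewrite ler_wsqrtr// ler_ln ?posrE//; last first.
  exact: lt_le_trans (expR_gt0 1) (ent_arg_ge cr).
have cT : (0 < #|T|)%N by rewrite (leq_trans cr)// max_card.
rewrite ler_pM2l ?expR_gt0// lef_pV2 ?posrE ?divr_gt0 ?ltr0n//.
rewrite /unif_meas ler_pM2r ?invr_gt0 ?ltr0n// ler_nat subset_leq_card//.
by apply/fintype.subsetP => x; rewrite !inE => /le_trans; apply.
Qed.

Let measurable_ball_ent (x : R) : 0 <= x -> measurable_fun `[0, x]%classic (EFin \o ball_ent).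
Proof.
move=> x0; apply/measurable_EFinP.
(* For negative r the ball may be empty and [ent] meets a division by 0; truncation at 0 makes the
   function monotone on the whole line. *)
apply: (eq_measurable_fun (fun r : R => ball_ent (Num.max 0 r))).
  by move=> r; rewrite inE/= in_itv/= => /andP[r0 _]; rewrite max_r.
apply: (measurable_funTS (nonincreasing_measurable measurableT _)) => r t rt.
apply: ball_ent_anti; first by rewrite le_max lexx.
exact: le_max2.
Qed.

(** Lower Riemann sum over the dyadic intervals from 2^-(k+1) x to 2^-k x, where the nonincreasing
    integrand is at least its value at the right end. The induction splits off the upper half and
    passes to x / 2. *)
Lemma entropy_lower (x : R) K : 0 <= x ->
  ((\sum_(0 <= k < K) 2^-1 ^+ k.+1 * x * ent [pred h | alpha h <= 2^-1 ^+ k * x])%:E <=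
   \int[mu]_(r in `[0%R, x]) (ent [pred h | (alpha h <= r)%R])%:E)%E.
Proof.
elim: K x => [|K IH] x x0.
  rewrite big_geq//; apply: integral_ge0 => r _; rewrite lee_fin; exact: sqrtr_ge0.
have hx0 : 0 <= x / 2 by rewrite divr_ge0.
have hxx : x / 2 <= x by lra.
have mb := measurable_ball_ent x0.
have split_itv : `[0, x]%classic = `[0, x / 2]%classic `|` `]x / 2, x]%classic.
  by rewrite -itv_bndbnd_setU// ?bnd_simp.
have sub2 : `]x / 2, x]%classic `<=` `[0, x]%classic.
  by rewrite split_itv; exact: subsetUr.
rewrite split_itv ge0_integral_setU//=; first last.
- apply/disj_setPS => r [] /=; rewrite !in_itv/= => /andP[_ a] /andP[b _].
  by move: b; rewrite ltNge a.
- by move=> r _; rewrite lee_fin sqrtr_ge0.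
- by rewrite -split_itv; exact: mb.
rewrite big_nat_recl//= addrC EFinD; apply: leeD.
  apply: le_trans (IH _ hx0); rewrite lee_fin le_eqVlt; apply/orP; left; apply/eqP.
  apply: eq_bigr => k _; rewrite !exprS.
  have -> : 2^-1 * 2^-1 ^+ k * x = 2^-1 ^+ k * (x / 2) by field.
  by congr (_ * _); field.
apply: (@le_trans _ _ (\int[mu]_(r in `](x / 2)%R, x]) cst (ball_ent x)%:E r)%E).
  rewrite integral_cst//= lebesgue_measure_itv/= lte_fin.
  have [xx|xx] := ltP (x / 2) x.
    rewrite -EFinB -EFinM lee_fin expr1 expr0 mul1r /ball_ent.
    by rewrite le_eqVlt; apply/orP; left; apply/eqP; field.
  have -> : x = 0 by lra.
  by rewrite mulr0 mul0r mule0.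
apply: ge0_le_integral => //.
- by move=> r _; rewrite lee_fin sqrtr_ge0.
- exact: (measurable_funS _ sub2 mb).
- move=> r /=; rewrite in_itv/= => /andP[a b]; rewrite lee_fin.
  by apply: ball_ent_anti => //; rewrite (le_trans hx0)// ltW.
Qed.

Lemma entropy_intE :
  (entropy_int (fun h => (alpha h)%:E) =
   \int[mu]_(r in `[0%R, \big[Num.max/0%R]_(h : T) alpha h]) (ent [pred h | (alpha h <= r)%R])%:E)%E.
Proof.
rewrite /entropy_int.
have -> : (\big[maxe/0]_(h : T) (alpha h)%:E = (\big[Num.max/0%R]_(h : T) alpha h)%:E)%E.
  by apply/esym; elim/big_ind2 : _ => // x1 x2 y1 y2 <- <-; rewrite EFin_max.
by congr integral; apply/seteqP; split=> r /=; rewrite in_itv/= !lee_fin.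
Qed.

End entropy.

(** * Comparison of the chaining sum with the entropy integral *)

Theorem corollary7p2 (R : realType) :
  exists C : R, 0 < C /\
  forall (T : finZmodType) (X : completeNormedModType R) (D : R)
    (d : measure_display) (Omega : measurableType d) (P : probability Omega R)
    (N : nat) (F : nat -> set (set Omega)) (m : nat -> nat)
    (gamma : forall i, Omega -> (m i).-tuple (measurableTypeR R))
    (A : forall i, T -> Omega -> {linear 'cV[R]_(m i) -> X})
    (sigma : T -> Omega -> R),
    separable X -> 1 <= D -> smooth2 X D ->
    predictable_gaussian P N F gamma A ->
    (forall h, measurable_fun [set: Omega] (sigma h)) ->
    (forall h w, 0 <= sigma h w) ->
    {ae P, forall w, forall t u, sq_dist N A w t u = (sigma (t - u) w)%:E} ->
    ('E_P[max_osc N gamma A] <=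
      (C * D)%:E * entropy_int (fun h => 'E_P[sigma h]))%E.
Proof.
(* 1664 = 4 * 416: the weights of the chaining sum and of the Riemann sum differ by a factor 4 on
   equal balls. *)
have [C C0 CE] : exists2 C : R, 0 < C & C = 1664 by exists 1664; rewrite ?ltr0n.
exists C; split=> // T X D d Omega P N F m gamma A sigma sepX D1 sm Hpg msigma sigma0 Hd.
have [s sX] := separable_seq sepX.
have D0 : 0 < D by rewrite (lt_le_trans ltr01).
have CD0 : 0 < C * D by rewrite mulr_gt0.
have E0 h : (0 <= 'E_P[sigma h])%E by rewrite expectation_ge0.
have Es0 : ('E_P[sigma 0%R] = 0)%E.
  rewrite unlock -[RHS](integral0 P [set: Omega]); apply: ge0_ae_eq_integral => //.
  - by apply/measurable_EFinP; exact: msigma.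
  - by move=> w _; rewrite lee_fin.
  - by apply: filterS (sigma_zero sX Hd) => w ->.
(* [Es0] keeps 0 in every ball, so one infinite mean already makes the entropy integral infinite. *)
have [[h Eh]|fin] := pselect (exists h, ('E_P[sigma h] = +oo)%E).
  by rewrite (entropy_int_pinfty Es0 Eh) gt0_muley ?lte_fin// leey.
pose alpha h := fine ('E_P[sigma h])%E.
have Ealpha h : ('E_P[sigma h] = (alpha h)%:E)%E.
  rewrite fineK// ge0_fin_numE// ltey; apply/eqP => Eh; by apply: fin; exists h.
have a0 h : 0 <= alpha h by exact: fine_ge0.
have al0 : alpha 0 = 0 by rewrite /alpha Es0.
have -> : (fun h => 'E_P[sigma h])%E = (fun h => (alpha h)%:E)%E by apply/funext.
set Delta := \big[Num.max/0]_(h : T) alpha h.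
have aD h : alpha h <= Delta by exact: le_bigmax.
have chain De K := @gauss_chain R T X d Omega s sX P N F m gamma A sigma D D1 sm Hpg msigma
  sigma0 Hd alpha Ealpha De K.
set e0 := ent (pred1 (0 : T)) in chain.
have e01 : 1 <= e0 by apply: ent_ge1; rewrite card1.
rewrite entropy_intE -/Delta.
have De0 : 0 <= Delta by exact: bigmax_ge_id.
have [DeE|DeN] := eqVneq Delta 0.
  apply: (@le_trans _ _ 0%E); last first.
    rewrite mule_ge0 ?lee_fin ?(ltW CD0)//.
    by apply: integral_ge0 => r _; rewrite lee_fin sqrtr_ge0.
  (* When all means vanish, any positive number may serve as Delta in [gauss_chain]; with K = 0 the
     choice [e / k] makes the bound equal to e. *)
  apply/lee_addgt0Pr => e egt0; rewrite add0e.
  have [k k0 kE] : exists2 k, 0 < k & k = 416 * D * e0.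
    exists (416 * D * e0) => [|//]; apply: mulr_gt0 (lt_le_trans ltr01 e01).
    by apply: mulr_gt0 D0; rewrite ltr0n.
  have ek0 := divr_gt0 egt0 k0.
  apply: le_trans (chain (e / k) 0%N ek0 _) _.
    by move=> h; rewrite (le_trans (aD h))// DeE ltW.
  rewrite big_geq// add0r expr0 mul1r lee_fin le_eqVlt; apply/orP; left; apply/eqP.
  by rewrite mulrCA -kE divfK ?gt_eqF.
have Dpos : 0 < Delta by rewrite lt_neqAle eq_sym DeN.
have [K eK] : exists K, 2^-1 ^+ K * e0 <= 1.
  exists (Num.bound e0); have h : e0 < (Num.bound e0)%:R by apply/archi_boundP/(le_trans ler01).
  rewrite exprVn mulrC ler_pdivrMr ?exprn_gt0// mul1r (le_trans (ltW h))//.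
  by rewrite -natrX ler_nat ltnW// ltn_expl.
apply: le_trans (chain Delta K Dpos aD) _.
(* One interval more than there are links between balls: interval k + 1 carries the same ball as
   link k, and interval 0 pays for the final jump. *)
have low := entropy_lower al0 K.+1 De0.
apply: (@le_trans _ _ ((C * D)%:E * (\sum_(0 <= k < K.+1) 2^-1 ^+ k.+1 * Delta *
   ent [pred h | alpha h <= 2^-1 ^+ k * Delta])%:E)%E); last first.
  by rewrite lee_wpmul2l// lee_fin ltW.
rewrite -EFinM lee_fin big_nat_recl//= expr0 mul1r expr1.
have -> : ent [pred h | alpha h <= Delta] = 1 :> R.
  have cT : #|[pred h | alpha h <= Delta]| = #|T| by apply: eq_card => h; rewrite !inE aD.
  rewrite /ent /unif_meas cT.
  by rewrite divff ?gt_eqF ?cardT_gt0// divr1 expRK sqrtr1.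
set S := \sum_(0 <= k < K) 2^-1 ^+ k * _ * _.
have -> : \sum_(0 <= k < K) 2^-1 ^+ k.+2 * Delta * ent [pred h | alpha h <= 2^-1 ^+ k.+1 * Delta] = S / 4.
  by rewrite /S mulr_suml; apply: eq_bigr => k _; rewrite -(addn2 k) exprD; field.
have h1 : 2^-1 ^+ K * Delta * e0 <= Delta.
  by rewrite mulrAC ler_piMl.
(* The two sides differ by 416 times this quantity: the [S] terms cancel, and the top interval
   contributes 1664 / 2 = 2 * 416 times D Delta. *)
have : 0 <= D * (2 * Delta - 2^-1 ^+ K * Delta * e0) by rewrite mulr_ge0 ?(ltW D0)//; lra.
by rewrite CE; lra.
Qed.
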